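(* Let $\pi:\mathbb{R}^m\times\mathbb{R}^{n_w}\to\mathbb{R}^p$ be continuously differentiable. Let $F\in\mathbb{R}^{p\times m}$, $G\in\mathbb{R}^{p\times n_{\mathsf p}}$, $E_1\in\mathbb{R}^{p\times n_w}$, $H\in\mathbb{R}^{n_{\mathsf q}\times m}$, $J\in\mathbb{R}^{n_{\mathsf q}\times n_{\mathsf p}}$, $E_2\in\mathbb{R}^{n_{\mathsf q}\times n_w}$ be fixed matrices, and let $\boldsymbol{\Delta}$ be a set of functions $\Delta:\mathbb{R}^{n_{\mathsf q}}\to\mathbb{R}^{n_{\mathsf p}}$ such that for every $\Delta\in\boldsymbol{\Delta}$ the map $\mathsf q\mapsto\mathsf q-J\Delta(\mathsf q)$ is invertible on $\mathbb{R}^{n_{\mathsf q}}$. For $\Delta\in\boldsymbol{\Delta}$ let $\pi_\Delta:\mathbb{R}^m\times\mathbb{R}^{n_w}\to\mathbb{R}^p$, $\tilde e=\pi_\Delta(u,w)$, be the function defined by $$\tilde e=Fu+G\mathsf p+E_1w,\qquad \mathsf q=Hu+J\mathsf p+E_2w,\qquad \mathsf p=\Delta(\mathsf q),$$ and let $\Pi:=\{\pi_\Delta:\Delta\in\boldsymbol{\Delta}\}$. Let $\boldsymbol{\Theta}$ be a convex cone of symmetric $(n_{\mathsf p}+n_{\mathsf q})\times(n_{\mathsf p}+n_{\mathsf q})$ matrices such that $$\begin{bmatrix}\Delta(\mathsf q)-\Delta(\mathsf q')\\ \mathsf q-\mathsf q'\end{bmatrix}^{\mathsf T}\Theta\begin{bmatrix}\Delta(\mathsf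 q)-\Delta(\mathsf q')\\ \mathsf q-\mathsf q'\end{bmatrix}\ge0\quad\text{for all }\mathsf q,\mathsf q'\in\mathbb{R}^{n_{\mathsf q}},\ \Theta\in\boldsymbol{\Theta},\ \Delta\in\boldsymbol{\Delta}.$$ Assume $\pi\in\Pi$. Let $\gamma\ge0$ and $\Theta_\gamma:=\begin{bmatrix}-\gamma^2I_{n_w} & 0 \\ 0 & I_p\end{bmatrix}$. Suppose there exist $K\in\mathbb{R}^{m\times p}$, a symmetric positive definite $P\in\mathbb{R}^{p\times p}$, and $\Theta\in\boldsymbol{\Theta}$ such that $$M^{\mathsf T}\begin{bmatrix} 0 & P & 0 & 0 \\ P & 0 & 0 & 0 \\ 0 & 0 & \Theta & 0 \\ 0 & 0 & 0 & \Theta_\gamma \end{bmatrix}M\prec0,\qquad M:=\begin{bmatrix} I_p & 0 & 0 \\ -F K & -G & -E_1 \\ 0 & I_{n_{\mathsf p}} & 0 \\ H K & J & E_2 \\ 0 & 0 & I_{n_w} \\ F K & G & E_1 \end{bmatrix},$$ where in the block-diagonal middle matrix $\Theta$ acts on the third and fourth block rows of $M$ and $\Theta_\gamma$ acts on the fifth and sixth. Consider the reduced dynamics $$\dot\eta(t)=-\pi(K\eta(t),w(t)),\quad \eta(0)=\eta_0,\qquad e(t)=\pi(K\eta(t),w(t)).$$ Then: 1) the system $\dot\eta=-\pi(K\eta,w)$, with parameter $w\in\mathbb{R}^{n_w}$, is uniformly infinitesimally contracting with respect to the norm $\|x\|=(x^{\mathsf T}Px)^{1/2}$ on $\mathbb{R}^p$;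 2) the incremental $\mathscr{L}_2$-gain of the reduced dynamics (from $w$ to $e$) is less than or equal to $\gamma$.
   Context: Matrix measure: for a vector norm $\|\cdot\|$ on $\mathbb{R}^p$, with $\|\cdot\|$ also denoting the induced matrix norm, the associated matrix measure is $\mu(A):=\lim_{h\to0^+}\frac1h(\|I_p+hA\|-1)$ for $A\in\mathbb{R}^{p\times p}$. Uniform infinitesimal contraction: for $f(\eta,w)\in\mathbb{R}^p$ continuously differentiable in $\eta\in\mathbb{R}^p$ with parameter $w\in\mathbb{R}^{n_w}$, the system $\dot\eta=f(\eta,w)$ is uniformly infinitesimally contracting with respect to $\|\cdot\|$ on $\mathbb{R}^p$ if there exists $\rho>0$ such that $\mu\big(\tfrac{\partial f}{\partial\eta}(\eta,w)\big)\le-\rho$ for all $\eta\in\mathbb{R}^p$ and all $w\in\mathbb{R}^{n_w}$, where $\mu$ is the matrix measure associated with $\|\cdot\|$. Signal spaces: $\mathscr{L}_{2e}^{q}[0,\infty)$ is the set of measurable maps $\mathbb{R}\to\mathbb{R}^q$ that are zero for $t<0$ and for which $t\mapsto\|\cdot\|_2^2$ is integrable on $[0,T]$ for all $T>0$. Incremental $\mathscr{L}_2$-gain: let $e=\Sigma_{\eta_0}(w)$ denote the input-output map $\Sigma_{\eta_0}:\mathscr{L}_{2e}^{n_w}[0,\infty)\to\mathscr{L}_{2e}^{p}[0,\infty)$ defined by the reduced dynamics with initial condition $\eta_0$. The reduced dynamics have incremental $\mathscr{L}_2$-gain less than or equal to $\gamma\ge0$ if there exists $\beta\ge0$ such that $$\int_0^T\|e(t)-e'(t)\|_2^2\,dt\le\beta\|\eta_0-\eta_0'\|_2^2+\gamma^2\int_0^T\|w(t)-w'(t)\|_2^2\,dt$$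 for all $T>0$, all initial conditions $\eta_0,\eta_0'\in\mathbb{R}^p$, and all $w,w'\in\mathscr{L}_{2e}^{n_w}[0,\infty)$, where $e=\Sigma_{\eta_0}(w)$ and $e'=\Sigma_{\eta_0'}(w')$. $X\prec0$ means that $X$ is symmetric and negative definite. *)

(* Defs.v *)
From HB Require Import structures.
From mathcomp Require Import all_boot all_order all_algebra.
From mathcomp Require Import all_classical all_reals all_analysis.
Set Implicit Arguments.
Unset Strict Implicit.
Unset Printing Implicit Defensive.
Import Order.TTheory GRing.Theory Num.Theory.
Import numFieldNormedType.Exports.
Local Open Scope classical_set_scope.
Local Open Scope ring_scope.

(* Vectors of R^n are column matrices 'cV[R]_n.  Their library norm, used only
   for topology and differentiability, is the max norm. *)

Section linear_algebra.
Context {R : realType}.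

Definition quad_form n (A : 'M[R]_n) (x : 'cV[R]_n) : R :=
  (x^T *m A *m x) ord0 ord0.

Definition posdef n (A : 'M[R]_n) : Prop :=
  A^T = A /\ forall x : 'cV[R]_n, x != 0 -> 0 < quad_form A x.

Definition negdef n (A : 'M[R]_n) : Prop :=
  A^T = A /\ forall x : 'cV[R]_n, x != 0 -> quad_form A x < 0.

Definition sqnorm2 n (x : 'cV[R]_n) : R := \sum_(i < n) x i ord0 ^+ 2.

Definition weighted_norm n (P : 'M[R]_n) (x : 'cV[R]_n) : R :=
  Num.sqrt (quad_form P x).

(* Stability under scaling is required for positive scalars only, so a cone
   need not contain 0. *)
Definition convex_cone n (C : set 'M[R]_n) : Prop :=
  @convex_set R 'M[R]_n C /\ forall (a : R) X, 0 < a -> C X -> C (a *: X).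

End linear_algebra.

Section contraction.
Context {R : realType}.

(* In finite dimension, continuity of x |-> 'd f x is the same for the operator
   norm and pointwise. *)
Definition continuously_differentiable (V W : normedModType R) (f : V -> W) :
    Prop :=
  (forall x, differentiable f x) /\
  (forall v, continuous (fun x => 'd f x v)).

(* The library's jacobian acts on row vectors; this is the one for columns. *)
Definition col_jacobian n k (f : 'cV[R]_n -> 'cV[R]_k) (x : 'cV[R]_n) :
    'M[R]_(k, n) :=
  \matrix_(i, j) ('d f x (delta_mx j ord0 : 'cV[R]_n)) i ord0.

Definition is_norm n (N : 'cV[R]_n -> R) : Prop :=
  [/\ forall x, N x = 0 -> x = 0,
      forall a x, N (a *: x) = `|a| * N x &
      forall x y, N (x + y) <= N x + N y].

Definition induced_norm n (N : 'cV[R]_n -> R) (A : 'M[R]_n) : R :=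
  sup [set N (A *m x) | x in [set x : 'cV[R]_n | N x <= 1]].

Definition matrix_measure n (N : 'cV[R]_n -> R) (A : 'M[R]_n) : R :=
  lim ((fun h : R => h^-1 * (induced_norm N (1%:M + h *: A) - 1)) @ 0^'+).

Definition uniformly_infinitesimally_contracting n k (N : 'cV[R]_n -> R)
    (f : 'cV[R]_n -> 'cV[R]_k -> 'cV[R]_n) : Prop :=
  [/\ is_norm N,
      forall w, continuously_differentiable (fun eta => f eta w) &
      exists2 rho : R, 0 < rho & forall eta w,
        matrix_measure N (col_jacobian (fun eta' => f eta' w) eta) <= - rho].

End contraction.

Section signals.
Context {R : realType}.
Let mu := @lebesgue_measure R.

Definition L2e q (w : R -> 'cV[R]_q) : Prop :=
  [/\ forall i, measurable_fun setT (fun t => w t i ord0),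
      forall t, t < 0 -> w t = 0 &
      forall T, 0 < T ->
        mu.-integrable `[0, T] (fun t => (sqnorm2 (w t))%:E)].

(* Caratheodory solution on [0, +oo[ of eta' = f(eta, w), eta(0) = eta0: since
   w is only locally square integrable, the differential equation is understood
   in integral form. *)
Definition ode_solution n k (f : 'cV[R]_n -> 'cV[R]_k -> 'cV[R]_n)
    (eta0 : 'cV[R]_n) (w : R -> 'cV[R]_k) (eta : R -> 'cV[R]_n) : Prop :=
  forall t, 0 <= t -> forall i,
    mu.-integrable `[0, t] (fun s => (f (eta s) (w s) i ord0)%:E) /\
    eta t i ord0 =
      eta0 i ord0 + \int[mu]_(s in `[0, t]) (f (eta s) (w s) i ord0).

Definition system_output n k q (f : 'cV[R]_n -> 'cV[R]_k -> 'cV[R]_n)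
    (g : 'cV[R]_n -> 'cV[R]_k -> 'cV[R]_q)
    (eta0 : 'cV[R]_n) (w : R -> 'cV[R]_k) (e : R -> 'cV[R]_q) : Prop :=
  exists2 eta, ode_solution f eta0 w eta &
    forall t, e t = if 0 <= t then g (eta t) (w t) else 0.

(* Sigma eta0 maps L2e to L2e, and Sigma eta0 w is the one and only output of
   the system eta' = f(eta, w), e = g(eta, w). *)
Definition io_map n k q (f : 'cV[R]_n -> 'cV[R]_k -> 'cV[R]_n)
    (g : 'cV[R]_n -> 'cV[R]_k -> 'cV[R]_q)
    (Sigma : 'cV[R]_n -> (R -> 'cV[R]_k) -> (R -> 'cV[R]_q)) : Prop :=
  forall eta0 w, L2e w ->
    L2e (Sigma eta0 w) /\
    forall e, system_output f g eta0 w e <-> e = Sigma eta0 w.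

(* The existence of the input-output map is part of the property. *)
Definition incremental_L2_gain_le n k q
    (f : 'cV[R]_n -> 'cV[R]_k -> 'cV[R]_n)
    (g : 'cV[R]_n -> 'cV[R]_k -> 'cV[R]_q) (gamma : R) : Prop :=
  exists2 Sigma, io_map f g Sigma &
  exists2 beta : R, 0 <= beta &
    forall (T : R) (eta0 eta0' : 'cV[R]_n) (w w' : R -> 'cV[R]_k),
      0 < T -> L2e w -> L2e w' ->
      (\int[mu]_(t in `[0%R, T])
          (sqnorm2 (Sigma eta0 w t - Sigma eta0' w' t))%:E
       <= (beta * sqnorm2 (eta0 - eta0'))%:E
          + (gamma ^+ 2)%:E *
            \int[mu]_(t in `[0%R, T]) (sqnorm2 (w t - w' t))%:E)%E.

End signals.

Section uncertainty.
Context {R : realType} {m nw p np nq : nat}.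

(* The interconnection defines a function when q |-> q - J Delta(q) is
   bijective; xget then picks the unique e~ that satisfies the equations. *)
Definition lft
    (F : 'M[R]_(p, m)) (G : 'M[R]_(p, np)) (E1 : 'M[R]_(p, nw))
    (H : 'M[R]_(nq, m)) (J : 'M[R]_(nq, np)) (E2 : 'M[R]_(nq, nw))
    (Delta : 'cV[R]_nq -> 'cV[R]_np)
    (uw : 'cV[R]_m * 'cV[R]_nw) : 'cV[R]_p :=
  xget 0 [set e | exists pv qv,
    [/\ e = F *m uw.1 + G *m pv + E1 *m uw.2,
        qv = H *m uw.1 + J *m pv + E2 *m uw.2 &
        pv = Delta qv]].

Definition lmi_outer
    (F : 'M[R]_(p, m)) (G : 'M[R]_(p, np)) (E1 : 'M[R]_(p, nw))
    (H : 'M[R]_(nq, m)) (J : 'M[R]_(nq, np)) (E2 : 'M[R]_(nq, nw))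
    (K : 'M[R]_(m, p)) :
    'M[R]_((p + p) + (np + nq) + (nw + p), p + np + nw) :=
  col_mx
    (col_mx
      (col_mx (row_mx (row_mx 1%:M 0) 0)
              (row_mx (row_mx (- (F *m K)) (- G)) (- E1)))
      (col_mx (row_mx (row_mx 0 1%:M) 0)
              (row_mx (row_mx (H *m K) J) E2)))
    (col_mx (row_mx (row_mx 0 0) 1%:M)
            (row_mx (row_mx (F *m K) G) E1)).

Definition theta_gain (gamma : R) : 'M[R]_(nw + p) :=
  block_mx (- (gamma ^+ 2)%:M) 0 0 1%:M.

Definition lmi_middle (P : 'M[R]_p) (Theta : 'M[R]_(np + nq)) (gamma : R) :
    'M[R]_((p + p) + (np + nq) + (nw + p)) :=
  block_mx (block_mx (block_mx 0 P P 0) 0 0 Theta) 0 0 (theta_gain gamma).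

End uncertainty.

(* Main.v *)
(** Writing de for the difference of two outputs, the multiplier condition on
    Delta turns the LMI into the incremental dissipation inequality
      c |dx|^2 <= 2 dx^T P de + gamma^2 |dw|^2 - |de|^2,    c > 0.
    With dw = 0, differentiating along a line gives
    v^T P (df/dx) v <= - c/2 |v|^2, hence contraction in the P-norm.  By Young's
    inequality it also makes (x, w) |-> pi (K x, w) globally Lipschitz, so that
    Caratheodory solutions exist and are unique by Picard iteration in the
    norm sup_t e^(-2Lt) |x(t)|.  Integrated along two solutions, with
    V = dx^T P dx and dV/dt = - 2 dx^T P de, it is the gain estimate.  The
    solutions are only absolutely continuous; the inequality for V is integrated
    without almost everywhere derivatives, by comparing increments of V with
    increments of the primitive up to a quadratic error. *)

Require Import Defs.
From HB Require Import structures.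
From mathcomp Require Import all_boot all_order all_algebra.
From mathcomp Require Import all_classical all_reals all_analysis.
From mathcomp Require Import measurable_realfun ring lra.
Import Order.TTheory GRing.Theory Num.Theory.
Import numFieldNormedType.Exports.
Local Open Scope classical_set_scope.
Local Open Scope ring_scope.
Set Implicit Arguments.
Unset Strict Implicit.
Unset Printing Implicit Defensive.

(** * Quadratic forms and the dissipation inequality *)

Section bilinear_form.
Context {R : realType}.

Definition bilin_form n (A : 'M[R]_n) (x y : 'cV[R]_n) : R :=
  (x^T *m A *m y) ord0 ord0.

Lemma bilin_formDl n (A : 'M[R]_n) x x' y :
  bilin_form A (x + x') y = bilin_form A x y + bilin_form A x' y.
Proof. by rewrite /bilin_form linearD/= !mulmxDl mxE. Qed.

Lemma bilin_formDr n (A : 'M[R]_n) x y y' :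
  bilin_form A x (y + y') = bilin_form A x y + bilin_form A x y'.
Proof. by rewrite /bilin_form !mulmxDr mxE. Qed.

Lemma bilin_formZl n (A : 'M[R]_n) a x y :
  bilin_form A (a *: x) y = a * bilin_form A x y.
Proof. by rewrite /bilin_form linearZ/= -!scalemxAl mxE. Qed.

Lemma bilin_formZr n (A : 'M[R]_n) a x y :
  bilin_form A x (a *: y) = a * bilin_form A x y.
Proof. by rewrite /bilin_form -!scalemxAr mxE. Qed.

Lemma bilin_formNl n (A : 'M[R]_n) x y :
  bilin_form A (- x) y = - bilin_form A x y.
Proof. by rewrite -scaleN1r bilin_formZl mulN1r. Qed.

Lemma bilin_formNr n (A : 'M[R]_n) x y :
  bilin_form A x (- y) = - bilin_form A x y.
Proof. by rewrite -scaleN1r bilin_formZr mulN1r. Qed.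

Lemma bilin_formE n (A : 'M[R]_n) x y :
  bilin_form A x y = \sum_i \sum_j A i j * x i ord0 * y j ord0.
Proof.
rewrite /bilin_form mxE exchange_big; apply: eq_bigr => j _ /=.
by rewrite mxE mulr_suml; apply: eq_bigr => i _; rewrite mxE [x i _ * _]mulrC.
Qed.

Lemma bilin_formC n (A : 'M[R]_n) x y : A^T = A ->
  bilin_form A x y = bilin_form A y x.
Proof.
move=> As; rewrite !bilin_formE exchange_big; apply: eq_bigr => i _ /=.
by apply: eq_bigr => j _; rewrite -{1}As mxE mulrAC.
Qed.

Lemma bilin_form_diag n (A : 'M[R]_n) x : bilin_form A x x = quad_form A x.
Proof. by []. Qed.

Lemma quad_formD n (A : 'M[R]_n) x y : A^T = A ->
  quad_form A (x + y) = quad_form A x + 2 * bilin_form A x y + quad_form A y.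
Proof.
move=> As; rewrite -!bilin_form_diag !bilin_formDl !bilin_formDr.
rewrite (bilin_formC y x As); ring.
Qed.

Lemma quad_formZ n (A : 'M[R]_n) a x : quad_form A (a *: x) = a ^+ 2 *
  quad_form A x.
Proof. by rewrite -!bilin_form_diag bilin_formZl bilin_formZr mulrA expr2. Qed.

Lemma quad_form0 n (A : 'M[R]_n) : quad_form A 0 = 0.
Proof. by rewrite /quad_form mulmx0 mxE. Qed.

Lemma quad_formN n (A : 'M[R]_n) x : quad_form (- A) x = - quad_form A x.
Proof. by rewrite /quad_form mulmxN mulNmx mxE. Qed.

Lemma quad_form_sub_eq n (A : 'M[R]_n) x y : A^T = A ->
  quad_form A x - quad_form A y = bilin_form A (x - y) (x + y).
Proof.
move=> As; rewrite -!bilin_form_diag !(bilin_formDl, bilin_formDr,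
  bilin_formNl).
rewrite (bilin_formC y x As); ring.
Qed.

Lemma quad_form_congr n k (A : 'M[R]_n) (B : 'M[R]_(n, k)) x :
  quad_form (B^T *m A *m B) x = quad_form A (B *m x).
Proof. by rewrite /quad_form trmx_mul !mulmxA. Qed.

Lemma sqnorm2_ge0 n (x : 'cV[R]_n) : 0 <= sqnorm2 x.
Proof. by apply: sumr_ge0 => i _; exact: sqr_ge0. Qed.

Lemma sqnorm2_0 n : sqnorm2 (0 : 'cV[R]_n) = 0.
Proof. by rewrite /sqnorm2 big1// => i _; rewrite mxE expr0n. Qed.

Lemma sqnorm2Z n a (x : 'cV[R]_n) : sqnorm2 (a *: x) = a ^+ 2 * sqnorm2 x.
Proof. by rewrite /sqnorm2 mulr_sumr; apply: eq_bigr => i _; rewrite mxE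
  exprMn. Qed.

Lemma sqnorm2N n (x : 'cV[R]_n) : sqnorm2 (- x) = sqnorm2 x.
Proof. by rewrite -scaleN1r sqnorm2Z sqrrN expr1n mul1r. Qed.

Lemma sqnorm2_quad_form n (x : 'cV[R]_n) : sqnorm2 x = quad_form 1%:M x.
Proof.
rewrite /quad_form mulmx1 mxE; apply: eq_bigr => i _.
by rewrite mxE expr2.
Qed.

Lemma sqnorm2_col_mx n k (x : 'cV[R]_n) (y : 'cV[R]_k) :
  sqnorm2 (col_mx x y) = sqnorm2 x + sqnorm2 y.
Proof.
rewrite /sqnorm2 big_split_ord; congr (_ + _); apply: eq_bigr => i _.
  by rewrite col_mxEu.
by rewrite col_mxEd.
Qed.

Lemma ler_coord_sqnorm2 n (x : 'cV[R]_n) i : x i ord0 ^+ 2 <= sqnorm2 x.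
Proof.
rewrite /sqnorm2 (bigD1 i)//= lerDl; apply: sumr_ge0 => j _; exact: sqr_ge0.
Qed.

Lemma sqnorm2D_le n (x y : 'cV[R]_n) :
  sqnorm2 (x + y) <= 2 * sqnorm2 x + 2 * sqnorm2 y.
Proof.
rewrite /sqnorm2 !mulr_sumr -big_split/=; apply: ler_sum => i _; rewrite mxE.
have := sqr_ge0 (x i ord0 - y i ord0); nra.
Qed.

Lemma bilin_form_le n (A : 'M[R]_n) : exists2 c : R, 0 < c &
  forall x y, `|bilin_form A x y| <= c * (sqnorm2 x + sqnorm2 y).
Proof.
exists (1 + \sum_i \sum_j `|A i j|).
  rewrite ltr_pwDl//; apply: sumr_ge0 => i _; apply: sumr_ge0 => j _//.
move=> x y; rewrite bilin_formE mulrDl.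
set S := sqnorm2 x + sqnorm2 y.
have S0 : 0 <= S by rewrite addr_ge0// sqnorm2_ge0.
rewrite mul1r; apply: ler_wpDl => //.
rewrite mulr_suml; apply: (le_trans (ler_norm_sum _ _ _)); apply: ler_sum => i
  _.
rewrite mulr_suml; apply: (le_trans (ler_norm_sum _ _ _)); apply: ler_sum => j
  _.
rewrite -mulrA normrM; apply: ler_wpM2l => //.
have := ler_coord_sqnorm2 x i; have := ler_coord_sqnorm2 y j.
rewrite /S normrM -[x i ord0 ^+ 2]real_normK ?num_real// -[y j ord0 ^+
  2]real_normK ?num_real//.
have := sqr_ge0 (`|x i ord0| - `|y j ord0|); have := normr_ge0 (x i ord0); have
  := normr_ge0 (y j ord0).
set a := `|_|; set b := `|_|; nra.
Qed.

Lemma quad_form_le n (A : 'M[R]_n) : exists2 c : R, 0 < c &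
  forall x, quad_form A x <= c * sqnorm2 x.
Proof.
have [c c0 Hc] := bilin_form_le A; exists (2 * c); first by rewrite mulr_gt0.
move=> x; rewrite -bilin_form_diag (le_trans (ler_norm _))// (le_trans (Hc x
  x))//.
by rewrite -[sqnorm2 x + _]mulr2n -[sqnorm2 x *+ _]mulr_natl mulrCA mulrA.
Qed.

Lemma posdef_ge0 n (A : 'M[R]_n) x : posdef A -> 0 <= quad_form A x.
Proof.
move=> [_ A0]; have [->|/A0/ltW//] := eqVneq x 0; by rewrite quad_form0.
Qed.

(** The form is nonnegative at [quad_form A y *: x - bilin_form A x y *: y], and its value there is
    [quad_form A y] times the right side minus the left side. *)
Lemma bilin_form_CauchySchwarz n (A : 'M[R]_n) x y : posdef A ->
  bilin_form A x y ^+ 2 <= quad_form A x * quad_form A y.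
Proof.
move=> pA; have [As A0] := pA.
have [->|y0] := eqVneq y 0.
  by rewrite /bilin_form mulmx0 mxE quad_form0 mulr0 expr0n.
have qy := A0 _ y0; rewrite -subr_ge0 -(pmulr_rge0 _ qy).
have := posdef_ge0 (quad_form A y *: x - bilin_form A x y *: y) pA.
rewrite quad_formD// -scaleNr !quad_formZ bilin_formZl bilin_formZr.
set a := bilin_form A x y; set b := quad_form A y; set c := quad_form A x; nra.
Qed.

(* The i-th coordinate is the inner product with A^-1 e_i in the scalar product
   of A, so that Cauchy-Schwarz bounds it by the A-norm. *)
Lemma posdef_coercive n (A : 'M[R]_n) : posdef A ->
  exists2 c : R, 0 < c & forall x, c * sqnorm2 x <= quad_form A x.
Proof.
move=> pA; have [As A0] := pA.
have uA : A \in unitmx.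
  rewrite -row_free_unit -kermx_eq0; apply/rowV0P => v /sub_kermxP vA.
  apply/eqP/negPn/negP => v0; have := A0 v^T; rewrite -trmx0 (inj_eq trmx_inj)
    => /(_ v0).
  by rewrite /quad_form trmxK vA mul0mx mxE ltxx.
pose e i : 'cV[R]_n := invmx A *m delta_mx i ord0.
pose S := \sum_i quad_form A (e i).
have S0 : 0 <= S by apply: sumr_ge0 => i _; exact: posdef_ge0.
exists (1 + S)^-1; first by rewrite invr_gt0 ltr_pwDl.
move=> x; rewrite ler_pdivrMl ?ltr_pwDl// mulrDl mul1r; apply: ler_wpDl; first
  exact: posdef_ge0.
rewrite /sqnorm2 /S mulr_suml; apply: ler_sum => i _.
rewrite mulrC (le_trans _ (bilin_form_CauchySchwarz x (e i) pA))// /bilin_form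
  /e.
rewrite -mulmxA [A *m _]mulmxA mulmxV// mul1mx -colE !mxE.
by [].
Qed.

Lemma negdef_coercive n (A : 'M[R]_n) : negdef A ->
  exists2 c : R, 0 < c & forall x, quad_form A x <= - (c * sqnorm2 x).
Proof.
move=> [As A0]; have pA : posdef (- A).
  split=> [|x x0]; first by rewrite linearN/= As.
  by rewrite quad_formN oppr_gt0 A0.
have [c c0 Hc] := posdef_coercive pA.
by exists c => // x; rewrite lerNr -quad_formN.
Qed.

Lemma quad_form_block_diag n k (A : 'M[R]_n) (B : 'M[R]_k) x y :
  quad_form (block_mx A 0 0 B) (col_mx x y) = quad_form A x + quad_form B y.
Proof.
rewrite /quad_form tr_col_mx mul_row_block mul_row_col !mulmx0 addr0 add0r.
by rewrite mxE.
Qed.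

Lemma quad_form_block_offdiag n (P : 'M[R]_n) x y : P^T = P ->
  quad_form (block_mx 0 P P 0) (col_mx x y) = 2 * bilin_form P x y.
Proof.
move=> Ps; rewrite /quad_form tr_col_mx mul_row_block mul_row_col !mulmx0 addr0
  add0r.
by rewrite mxE -/(bilin_form P y x) (bilin_formC y x Ps) -mulr2n mulr_natl.
Qed.

Lemma quad_form_theta_gain nw p (gamma : R) (w : 'cV[R]_nw) (e : 'cV[R]_p) :
  quad_form (theta_gain gamma) (col_mx w e) = sqnorm2 e - gamma ^+ 2 * sqnorm2
    w.
Proof.
rewrite quad_form_block_diag -sqnorm2_quad_form quad_formN addrC; congr (_ - _).
by rewrite sqnorm2_quad_form -scalemx1 /quad_form -scalemxAr -scalemxAl mxE.
Qed.

End bilinear_form.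

(** * From the LMI to incremental dissipation and a growth bound on the output *)

Section reduced_dynamics.
Context {R : realType} {m nw p np nq : nat}.
Variables (pi : 'cV[R]_m * 'cV[R]_nw -> 'cV[R]_p).
Variables (F : 'M[R]_(p, m)) (G : 'M[R]_(p, np)) (E1 : 'M[R]_(p, nw)).
Variables (H : 'M[R]_(nq, m)) (J : 'M[R]_(nq, np)) (E2 : 'M[R]_(nq, nw)).
Variables (K : 'M[R]_(m, p)) (P : 'M[R]_p) (Theta : 'M[R]_(np + nq)).
Variable gamma : R.
Implicit Types (x : 'cV[R]_p) (w : 'cV[R]_nw).

(** The inverse of q - J Delta(q), applied to H u + E2 w, gives a signal q that closes the loop. So
    the set under [xget] is inhabited and the default 0 is not returned by default. *)
Lemma lft_solution (Delta : 'cV[R]_nq -> 'cV[R]_np) uw :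
  bijective (fun q : 'cV[R]_nq => q - J *m Delta q) ->
  exists q, lft F G E1 H J E2 Delta uw =
      F *m uw.1 + G *m Delta q + E1 *m uw.2 /\
    q = H *m uw.1 + J *m Delta q + E2 *m uw.2.
Proof.
move=> [inv _ invK]; rewrite /lft; case: xgetP => [e _ [pv [qv [-> qE
  pE]]]|nex].
  by subst pv; exists qv.
pose q := inv (H *m uw.1 + E2 *m uw.2).
exfalso; apply: (nex (F *m uw.1 + G *m Delta q + E1 *m uw.2)).
exists (Delta q), q; split=> //; have := invK (H *m uw.1 + E2 *m uw.2).
by move/(congr1 (+%R^~ (J *m Delta q))); rewrite -/q subrK => {1}->; rewrite
  addrAC.
Qed.

Lemma lmi_outer_mul x (pv : 'cV[R]_np) w :
  lmi_outer F G E1 H J E2 K *m col_mx (col_mx x pv) w =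
  col_mx (col_mx (col_mx x (- (F *m (K *m x) + G *m pv + E1 *m w)))
            (col_mx pv (H *m (K *m x) + J *m pv + E2 *m w)))
         (col_mx w (F *m (K *m x) + G *m pv + E1 *m w)).
Proof.
rewrite /lmi_outer !mul_col_mx !mul_row_col !mul1mx !mul0mx !addr0 !add0r.
by rewrite !mulNmx !mulmxA !opprD.
Qed.

(** The LMI is evaluated at the stacked differences of x, Delta(q) and w, which [lmi_outer] maps to
    the differences of all loop signals. The [Theta] term is nonnegative and is dropped; of the
    coercivity bound only the part in x - x' is kept. *)
Lemma lmi_incremental (Delta : 'cV[R]_nq -> 'cV[R]_np) :
  bijective (fun q : 'cV[R]_nq => q - J *m Delta q) ->
  (forall q q', 0 <= quad_form Theta (col_mx (Delta q - Delta q') (q - q'))) ->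
  P^T = P ->
  (let M := lmi_outer F G E1 H J E2 K in
       negdef (M^T *m lmi_middle P Theta gamma *m M)) ->
  lft F G E1 H J E2 Delta = pi ->
  exists2 c : R, 0 < c & forall x x' w w',
    let de : 'cV[R]_p := pi (K *m x, w) - pi (K *m x', w') in
    c * sqnorm2 (x - x') <=
      2 * bilin_form P (x - x') de + gamma ^+ 2 * sqnorm2 (w - w') - sqnorm2 de.
Proof.
move=> Dbij qc Ps /= /negdef_coercive[c c0 Hc] <-; exists c => // x x' w w' /=.
have [q [-> qE]] := lft_solution (K *m x, w) Dbij.
have [q' [-> qE']] := lft_solution (K *m x', w') Dbij.
rewrite /= in qE qE' *.
have -> : F *m (K *m x) + G *m Delta q + E1 *m w -
   (F *m (K *m x') + G *m Delta q' + E1 *m w') =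
   F *m (K *m (x - x')) + G *m (Delta q - Delta q') + E1 *m (w - w').
  by rewrite !mulmxBr !opprD addrACA [_ + _ + (- _ - _)]addrACA.
(* The fourth block row of [lmi_outer] must be recognised as q - q' for the multiplier condition to
   apply. *)
have qB : q - q' = H *m (K *m (x - x')) + J *m (Delta q - Delta q') + E2 *m (w
  - w').
  by rewrite {1}qE {1}qE' !mulmxBr !opprD addrACA [_ + _ + (- _ - _)]addrACA.
have := Hc (col_mx (col_mx (x - x') (Delta q - Delta q')) (w - w')).
rewrite quad_form_congr lmi_outer_mul -qB /lmi_middle.
rewrite quad_form_block_diag quad_form_theta_gain quad_form_block_diag.
rewrite quad_form_block_offdiag// bilin_formNr.
rewrite !sqnorm2_col_mx; have := qc q q'.
have := sqnorm2_ge0 (Delta q - Delta q'); have := sqnorm2_ge0 (w - w').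
set a := sqnorm2 _; set b := sqnorm2 _; set t := quad_form _ _; set e :=
  sqnorm2 _.
set e' := sqnorm2 _; set bb := bilin_form _ _ _ => ? ? ? ?; nra.
Qed.

Lemma lmi_output_growth : P^T = P -> forall c : R, 0 < c ->
  (forall x x' w w',
    let de : 'cV[R]_p := pi (K *m x, w) - pi (K *m x', w') in
    c * sqnorm2 (x - x') <=
      2 * bilin_form P (x - x') de + gamma ^+ 2 * sqnorm2 (w - w') - sqnorm2
        de) ->
  exists2 a : R, 0 < a & forall x x' w w',
    sqnorm2 (pi (K *m x, w) - pi (K *m x', w')) <=
      a * (sqnorm2 (x - x') + sqnorm2 (w - w')).
Proof.
move=> Ps c c0 Hinc; have [d d0 Hd] := bilin_form_le P.
(* Once half of |de|^2 is absorbed on the left, the remaining coefficients of |dx|^2 and |dw|^2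
   double; their sum serves for both. *)
exists (4 * d * (1 + 4 * d) ^+ 2 + 2 * gamma ^+ 2).
  apply: ltr_wpDr; first by rewrite mulr_ge0// sqr_ge0.
  by rewrite !mulr_gt0// ltr_pwDl// mulr_ge0// ltW.
move=> x x' w w'; have /= := Hinc x x' w w'.
set dx := x - x'; set dw := w - w'; set de := pi _ - _ => Hde.
have s0 : 0 < 1 + 4 * d by rewrite ltr_pwDl// mulr_ge0// ltW.
(* Scaling dx by 1 + 4d and de by its inverse leaves the bilinear form unchanged. As 4d <= (1 +
   4d)^2, the coefficient of |de|^2 falls to at most one half. *)
have Hb : 2 * bilin_form P dx de <=
    2 * d * (1 + 4 * d) ^+ 2 * sqnorm2 dx + 2^-1 * sqnorm2 de.
  have := le_trans (ler_norm _) (Hd ((1 + 4 * d) *: dx) ((1 + 4 * d)^-1 *: de)).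
  rewrite bilin_formZl bilin_formZr mulVKf ?gt_eqF// !sqnorm2Z.
  have : 2 * d * (1 + 4 * d)^-1 ^+ 2 * sqnorm2 de <= 2^-1 * sqnorm2 de.
    apply: ler_wpM2r; first exact: sqnorm2_ge0.
    by rewrite exprVn ler_pdivrMr ?exprn_gt0//; nra.
  nra.
have := sqnorm2_ge0 dx; have := sqnorm2_ge0 dw; have := sqnorm2_ge0 de.
have : 0 <= d * (1 + 4 * d) ^+ 2 by rewrite mulr_ge0 ?sqr_ge0 ?ltW.
have := sqr_ge0 gamma.
have : 0 <= c * sqnorm2 dx by rewrite mulr_ge0 ?sqnorm2_ge0// ltW.
move: Hde Hb; move: (sqnorm2 dx) (sqnorm2 dw) (sqnorm2 de) (bilin_form _ _ _)
  => X W E B.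
rewrite -!(mulrA _ d).
move: (gamma ^+ 2) (d * _) (c * X) => g2 D C; nra.
Qed.

End reduced_dynamics.

(** * Matrix measures *)

Section matrix_norm.
Context {R : realType}.

Lemma ler_coord_normr n k (x : 'M[R]_(n, k)) i j : `|x i j| <= `|x|.
Proof.
rewrite [leRHS]/Num.norm/= mx_normrE.
exact: (@le_bigmax _ _ _ _ (fun ij => `|x ij.1 ij.2|) (i, j)).
Qed.

Lemma normr_mx_le n k (x : 'M[R]_(n, k)) (M : R) : 0 <= M ->
  (forall i j, `|x i j| <= M) -> `|x| <= M.
Proof.
move=> M0 Hx; rewrite [leLHS]/Num.norm/= mx_normrE; by apply/bigmax_leP; split.
Qed.

Lemma normr_cV_le_sum n (x : 'cV[R]_n) : `|x| <= \sum_i `|x i ord0|.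
Proof.
apply: normr_mx_le => [|i j]; first exact: sumr_ge0.
by rewrite ord1 (bigD1 i)//= lerDl sumr_ge0.
Qed.

Lemma mulmx_continuous n k (A : 'M[R]_(k, n)) :
  continuous (fun x : 'cV[R]_n => A *m x).
Proof.
apply/linear_bounded_continuous/bounded_funP => r.
exists (\sum_i \sum_j `|A i j| * r) => x xr.
apply: (le_trans (normr_cV_le_sum _)); apply: ler_sum => i _.
rewrite mxE (le_trans (ler_norm_sum _ _ _))//; apply: ler_sum => j _.
by rewrite normrM ler_wpM2l// (le_trans (ler_coord_normr _ _ _)).
Qed.

Lemma differentiable_mulmx n k (A : 'M[R]_(k, n)) x :
  differentiable (fun x : 'cV[R]_n => A *m x) x.
Proof. exact/linear_differentiable/mulmx_continuous. Qed.

Lemma diff_mulmx n k (A : 'M[R]_(k, n)) (x : 'cV[R]_n) :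
  'd (fun x : 'cV[R]_n => A *m x) x = (fun x => A *m x) :> (_ -> _).
Proof. by rewrite diff_lin//; exact: mulmx_continuous. Qed.

Lemma col_jacobianE n k (f : 'cV[R]_n -> 'cV[R]_k) x (v : 'cV[R]_n) :
  col_jacobian f x *m v = 'd f x v.
Proof.
rewrite [v in RHS]matrix_sum_delta linear_sum/=; apply/colP => i.
rewrite mxE summxE; apply: eq_bigr => j _.
by rewrite big_ord1 linearZ/= !mxE mulrC.
Qed.

Lemma bilin_form_continuous n (P : 'M[R]_n) v : continuous (bilin_form P v).
Proof.
move=> y; apply: (@continuous_comp _ _ _ (fun y => (v^T *m P) *m y) (fun z :
  'cV[R]_1 => z ord0 ord0)).
  exact: mulmx_continuous.
exact: coord_continuous.
Qed.

(** The hypothesis at x + h v and x, divided by h^2, bounds the form at the difference quotient for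
    either sign of h; the bound survives the limit because a closed half-line is closed. *)
Lemma bilin_form_diff_le n (P : 'M[R]_n) (f : 'cV[R]_n -> 'cV[R]_n) (c : R) x v
  :
  (forall x x', bilin_form P (x - x') (f x - f x') <= - (c * sqnorm2 (x - x')))
    ->
  differentiable f x -> bilin_form P v ('d f x v) <= - (c * sqnorm2 v).
Proof.
move=> Hf df; have dv : derivable f x v by exact: diff_derivable.
rewrite -deriveE//.
pose d (h : R) := h^-1 *: ((f \o shift x) (h *: v) - f x).
have cv : (bilin_form P v \o d) h @[h --> 0^'] --> bilin_form P v ('D_v f x).
  by apply: continuous_cvg => //; exact: bilin_form_continuous.
apply: (closed_cvg (fun y => y <= - (c * sqnorm2 v)) _ _ _ cv).
  exact: closed_le.
near=> h.
have h0 : h != 0 by near: h; exact: nbhs_dnbhs_neq.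
have := Hf (h *: v + x) x; rewrite addrK bilin_formZl sqnorm2Z /d /=
  bilin_formZr.
rewrite /shift/= => Hh.
have hh : 0 < h ^+ 2 by rewrite exprn_even_gt0.
rewrite -(ler_pM2l hh) expr2 -mulrA mulVKf// (le_trans Hh)//.
by rewrite mulrN mulrCA expr2 -!mulrA.
Unshelve. all: by end_near. Qed.

Lemma continuously_differentiable_comp_mulmx m n k q
    (g : 'cV[R]_m * 'cV[R]_k -> 'cV[R]_q) (A : 'M[R]_(m, n)) (w : 'cV[R]_k) :
  continuously_differentiable g ->
  continuously_differentiable (fun x : 'cV[R]_n => - g (A *m x, w)).
Proof.
move=> [dg cg].
pose a x : 'cV[R]_m * 'cV[R]_k := (A *m x, w).
have da x : differentiable a x.
  by apply: differentiable_pair => //; exact: differentiable_mulmx.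
have dga x : differentiable (g \o a) x by apply: differentiable_comp.
split=> [x|v]; first exact/differentiableN/dga.
have -> : (fun x => 'd (fun x => - g (A *m x, w)) x v) =
          (fun x => - 'd g (a x) (A *m v, 0)).
  apply/funext => x.
  have -> : (fun x => - g (A *m x, w)) = - (g \o a) by [].
  rewrite diffN//=; congr (- _).
  rewrite diff_comp//=; congr ('d g _ _).
  rewrite diff_pair//; last exact: differentiable_mulmx.
  by rewrite diff_mulmx diff_cst.
move=> x.
have ca : {for x, continuous a} by exact/differentiable_continuous/da.
exact: (continuousN (continuous_comp ca (cg (A *m v, 0) (a x)))).
Qed.

End matrix_norm.

Section weighted_norm.
Context {R : realType}.

Lemma sqr_weighted_norm n (P : 'M[R]_n) x : posdef P ->
  weighted_norm P x ^+ 2 = quad_form P x.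
Proof. by move=> pP; rewrite sqr_sqrtr// posdef_ge0. Qed.

Lemma weighted_norm_is_norm n (P : 'M[R]_n) : posdef P -> is_norm
  (weighted_norm P).
Proof.
move=> pP; have [Ps P0] := pP; split.
- move=> x /eqP; rewrite sqrtr_eq0 => Px.
  have [//|/P0] := eqVneq x 0; by rewrite ltNge Px.
- by move=> a x; rewrite /weighted_norm quad_formZ sqrtrM ?sqr_ge0// sqrtr_sqr.
- move=> x y; rewrite -(@ler_pXn2r _ 2) ?nnegrE ?addr_ge0 ?sqrtr_ge0//.
  rewrite sqrrD !sqr_weighted_norm// quad_formD// lerD2r lerD2l [leLHS]mulrC
    -[leRHS]mulr_natr ler_pM2r//.
  rewrite (le_trans (ler_norm _))// -sqrtr_sqr -sqrtrM ?posdef_ge0//.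
  by rewrite ler_wsqrtr// bilin_form_CauchySchwarz.
Qed.

(** Bounds the set whose supremum is [induced_norm], by comparing A^T P A with P through the
    Euclidean norm. *)
Lemma weighted_norm_mulmx_bounded n (P A : 'M[R]_n) : posdef P ->
  exists2 C : R, 0 <= C & forall x, weighted_norm P (A *m x) <= C *
    weighted_norm P x.
Proof.
move=> pP; have [a a0 Ha] := posdef_coercive pP.
have [b b0 Hb] := quad_form_le (A^T *m P *m A).
exists (Num.sqrt (b / a)); first exact: sqrtr_ge0.
move=> x; rewrite -sqrtrM ?divr_ge0 ?(ltW a0) ?(ltW b0)// ler_wsqrtr//.
rewrite -quad_form_congr (le_trans (Hb x))// -mulrA ler_pM2l//.
by rewrite ler_pdivlMl.
Qed.

End weighted_norm.

Section matrix_measure.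
Context {R : realType} {n : nat}.
Variable N : 'cV[R]_n -> R.
Hypothesis normN : is_norm N.
Hypothesis bndN : forall A : 'M[R]_n,
  exists2 C : R, 0 <= C & forall x, N (A *m x) <= C * N x.

Lemma is_norm_ge0 x : 0 <= N x.
Proof.
have [_ NZ ND] := normN; have := ND x (-1 *: x).
have := NZ 0 0; rewrite scale0r normr0 mul0r => N0.
by rewrite NZ normrN1 mul1r scaleN1r subrr N0 -mulr2n pmulrn_lge0.
Qed.

Lemma le_induced_norm (A : 'M[R]_n) x : N (A *m x) <= induced_norm N A * N x.
Proof.
have [Ndef NZ ND] := normN.
have [C C0 HC] := bndN A.
have [Nx0|Nx0] := eqVneq (N x) 0.
  have := HC x; by rewrite Nx0 !mulr0.
have Nx : 0 < N x by rewrite lt_def Nx0 is_norm_ge0.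
rewrite -ler_pdivrMr// mulrC -[X in X * _]ger0_norm ?invr_ge0 ?is_norm_ge0//
  -NZ.
rewrite scalemxAr; apply: ub_le_sup.
  exists C => _ [y /= y1 <-]; rewrite (le_trans (HC y))//.
  by rewrite -[leRHS]mulr1 ler_wpM2l.
exists ((N x)^-1 *: x) => //=.
by rewrite NZ ger0_norm ?invr_ge0 ?is_norm_ge0// mulVf.
Qed.

Lemma induced_norm_le (A : 'M[R]_n) (C : R) : 0 <= C ->
  (forall x, N (A *m x) <= C * N x) -> induced_norm N A <= C.
Proof.
move=> C0 HC; apply: ge_sup.
  exists (N (A *m 0)), 0 => //=; have [_ NZ _] := normN.
  by have := NZ 0 0; rewrite scale0r normr0 mul0r => ->.
move=> _ [x /= x1 <-]; rewrite (le_trans (HC x))//.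
by rewrite -[leRHS]mulr1 ler_wpM2l.
Qed.

Lemma induced_norm_ge0 (A : 'M[R]_n) : (0 < n)%N -> 0 <= induced_norm N A.
Proof.
move=> n0; have [Ndef NZ ND] := normN.
have [C C0 HC] := bndN A.
have N0 : N 0 = 0 by have := NZ 0 0; rewrite scale0r normr0 mul0r.
apply: ub_le_sup; last by exists 0 => /=; rewrite ?mulmx0 ?N0.
exists C => _ [y /= y1 <-]; rewrite (le_trans (HC y))//.
by rewrite -[leRHS]mulr1 ler_wpM2l.
Qed.

Let q (A : 'M[R]_n) (h : R) := h^-1 * (induced_norm N (1%:M + h *: A) - 1).

(* This is the convexity of h |-> N (1 + h A). *)
Lemma matrix_measure_quotient_nondecreasing A h k : (0 < n)%N ->
  0 < h -> h <= k -> q A h <= q A k.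
Proof.
move=> n0 h0 hk; have k0 := lt_le_trans h0 hk; have [Ndef NZ ND] := normN.
have hk1 : 0 <= 1 - h / k by rewrite subr_ge0 ler_pdivrMr// mul1r.
have hk0 : 0 <= h / k by rewrite divr_ge0// ltW.
have : induced_norm N (1%:M + h *: A) <=
    (1 - h / k) + h / k * induced_norm N (1%:M + k *: A).
  apply: induced_norm_le => [|x].
    by rewrite addr_ge0// mulr_ge0// induced_norm_ge0.
  have -> : (1%:M + h *: A) *m x =
      (1 - h / k) *: x + (h / k) *: ((1%:M + k *: A) *m x).
    rewrite !mulmxDl !mul1mx scalerDr addrA -scalerDl subrK scale1r -!scalemxAl.
    by rewrite scalerA divfK// gt_eqF.
  apply: (le_trans (ND _ _)); rewrite !NZ !ger0_norm// [leRHS]mulrDl lerD//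
    -[leRHS]mulrA.
  by apply: ler_wpM2l => //; exact: le_induced_norm.
rewrite /q ler_pdivrMl// mulrA.
set a := induced_norm _ _; set b := induced_norm _ _; lra.
Qed.

(** The triangle inequality N x <= N ((1 + h A) x) + h N (A x) at one nonzero vector. Together with
    monotonicity in h, this lower bound makes the limit at 0+ exist. *)
Lemma matrix_measure_quotient_ge A h : (0 < n)%N -> 0 < h ->
  - induced_norm N A <= q A h.
Proof.
move=> n0 h0; have [Ndef NZ ND] := normN.
(* Any nonzero vector would do, and one exists because n > 0. In dimension 0 the quotient is -1/h,
   which is unbounded below. *)
pose x : 'cV[R]_n := const_mx 1.
have x0 : N x != 0.
  apply/eqP => /Ndef /colP /(_ (Ordinal n0)); rewrite !mxE => /eqP.
  by rewrite oner_eq0.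
have Nx : 0 < N x by rewrite lt_def x0 is_norm_ge0.
rewrite /q ler_pdivlMl// lerBrDr.
rewrite -(ler_pM2r Nx) mulrDl mul1r -lerBrDl.
have xE : x = (1%:M + h *: A) *m x + (- h) *: (A *m x).
  by rewrite mulmxDl mul1mx -scalemxAl scaleNr addrK.
have := ND ((1%:M + h *: A) *m x) (- h *: (A *m x)); rewrite -xE NZ normrN
  gtr0_norm//.
have := le_induced_norm (1%:M + h *: A) x; have := le_induced_norm A x.
rewrite -(ler_pM2l h0); set a := induced_norm _ _; set b := induced_norm _ _;
  nra.
Qed.

(** The quotient is monotone and bounded below, so [lim] is a true limit and inherits the bound -
    rho that holds for all small h. *)
Lemma matrix_measure_le A (rho d : R) : (0 < n)%N -> 0 < d ->
  (forall h, 0 < h -> h < d -> induced_norm N (1%:M + h *: A) <= 1 - rho * h) ->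
  matrix_measure N A <= - rho.
Proof.
move=> n0 d0 Hd; apply: limr_le.
  apply: nondecreasing_at_right_is_cvgr; near=> x.
    move=> h k; rewrite !in_itv/= => /andP[h0 _] /andP[k0 _] hk.
    exact: matrix_measure_quotient_nondecreasing.
  exists (- induced_norm N A) => _ [h /= hx <-]; move: hx; rewrite in_itv/= =>
    /andP[h0 _].
  exact: matrix_measure_quotient_ge.
near=> h.
have h0 : 0 < h by [].
have hd : h < d by near: h; exact: nbhs_right_lt.
rewrite ler_pdivrMl//; have := Hd _ h0 hd; set a := induced_norm _ _; lra.
Unshelve. all: by end_near. Qed.

End matrix_measure.

(** In the expansion of the squared P-norm of (1 + h A) x, the first-order term is at most - 2 h c
    |x|^2. For small h the second-order term costs at most half of it, and what is left is at most -
    (c/b) h times the squared P-norm of x. Finally 1 - 2 r h <= (1 - r h)^2 with r = c/(2b). *)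
Lemma weighted_matrix_measure_le (R : realType) n (P A : 'M[R]_n) (c b : R) :
  (0 < n)%N -> posdef P -> 0 < c -> 0 < b ->
  (forall x, quad_form P x <= b * sqnorm2 x) ->
  (forall x, bilin_form P x (A *m x) <= - (c * sqnorm2 x)) ->
  matrix_measure (weighted_norm P) A <= - (c / (2 * b)).
Proof.
move=> n0 pP c0 b0 Hb Hc; have [Ps _] := pP.
have [a a0 Ha] := quad_form_le (A^T *m P *m A).
have ac0 : 0 < c / a by exact: divr_gt0.
have bc0 : 0 < 2 * b / c by rewrite divr_gt0 ?mulr_gt0.
(* Below c/a the second-order term is absorbed; below 2b/c the factor 1 - c h/(2b) is nonnegative,
   so that norms may be compared through their squares. *)
apply: (@matrix_measure_le _ _ _ _ _ _ _ (Num.min (c / a) (2 * b / c))) => //.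
- exact: weighted_norm_is_norm.
- by move=> B; exact: weighted_norm_mulmx_bounded.
- by rewrite lt_min ac0.
move=> h h0; rewrite lt_min => /andP[hca hbc].
have r0 : 0 <= 1 - c / (2 * b) * h.
  by rewrite subr_ge0 mulrC -ler_pdivlMr ?divr_gt0 ?mulr_gt0// mul1r invf_div
    ltW.
apply: induced_norm_le => //; first exact: weighted_norm_is_norm.
move=> x; rewrite -(@ler_pXn2r _ 2) ?nnegrE ?mulr_ge0 ?sqrtr_ge0//.
rewrite exprMn !sqr_weighted_norm//.
rewrite mulmxDl mul1mx -scalemxAl quad_formD// bilin_formZr quad_formZ.
rewrite -(quad_form_congr P).
have h1 : h ^+ 2 * quad_form (A^T *m P *m A) x <= h * c * sqnorm2 x.
  rewrite expr2 -!mulrA ler_pM2l// (le_trans (ler_wpM2l (ltW h0) (Ha x)))//.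
  by rewrite mulrA ler_wpM2r ?sqnorm2_ge0// -ler_pdivlMr// ltW.
have h2 : 2 * (h * bilin_form P x (A *m x)) <= - (2 * h * c * sqnorm2 x).
  by have := Hc x; rewrite -(ler_pM2l h0); nra.
have h3 : c / b * h * quad_form P x <= h * c * sqnorm2 x.
  have -> : c / b * h * quad_form P x = h * c * (b^-1 * quad_form P x) by ring.
  by rewrite ler_pM2l ?mulr_gt0// ler_pdivrMl.
have h4 : 0 <= (c / (2 * b) * h) ^+ 2 * quad_form P x.
  by rewrite mulr_ge0 ?sqr_ge0 ?posdef_ge0.
have e : 2 * (c / (2 * b)) = c / b by field; rewrite gt_eqF.
rewrite -e in h3; move: h1 h2 h3 h4; clear -h0.
move: (c / (2 * b)) (quad_form P x) (bilin_form _ _ _) (quad_form _ _) => r Q B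
  D.
move: (sqnorm2 x) => S; nra.
Qed.

(** * Caratheodory differential equations *)

Section integral_on_segments.
Context {R : realType}.
Local Notation mu := (@lebesgue_measure R).
Implicit Types (h : R -> R) (s t T : R).

(** Closes the Picard arguments and the bisection of the energy estimate, whose error bounds halve
    at every step. *)
Lemma le0_of_le_geometric (x a : R) :
  (forall k : nat, x <= a * 2^-1 ^+ k) -> x <= 0.
Proof.
move=> Hx; have cv : geometric a (2^-1 : R) @ \oo --> (0 : R).
  by apply: cvg_geometric; rewrite ger0_norm ?invr_ge0// invf_lt1 ?ltr1n.
rewrite -(cvg_lim _ cv)//; apply: limr_ge; first by apply/cvg_ex; exists 0.
by apply: nearW => k; exact: Hx.
Qed.

Lemma integrable_segmentS h s t : s <= t ->
  mu.-integrable `[0, t] (EFin \o h) -> mu.-integrable `[0, s] (EFin \o h).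
Proof.
move=> st; apply: integrableS => //; exact: subset_itvl.
Qed.

Lemma Rintegral_segment_itvoc h s t : 0 <= s -> s <= t ->
  mu.-integrable `[0, t] (EFin \o h) ->
  \int[mu]_(r in `[0, t]) h r - \int[mu]_(r in `[0, s]) h r =
  \int[mu]_(r in `]s, t]) h r.
Proof. by move=> s0 st ih; apply: Rintegral_itvB => //; rewrite bnd_simp. Qed.

Lemma integrable_cst_segment (a b c : R) : mu.-integrable `[a, b] (EFin \o cst
  c).
Proof.
apply: measurable_bounded_integrable => //.
  by rewrite /= lebesgue_measure_itv/=; case: ifPn => // _; rewrite -EFinB ltry.
exact: bounded_cst.
Qed.

Lemma le_normr_Rintegral_segment h t T : t <= T ->
  mu.-integrable `[0, T] (EFin \o h) ->
  `|\int[mu]_(r in `[0, t]) h r| <= \int[mu]_(r in `[0, T]) `|h r|.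
Proof.
move=> tT ih; have iht := integrable_segmentS tT ih.
apply: (le_trans (le_normr_Rintegral _ iht)) => //.
apply: fine_le.
- exact: (integrable_fin_num _ (integrable_norm iht)).
- exact: (integrable_fin_num _ (integrable_norm ih)).
apply: ge0_subset_integral => //; last exact: subset_itvl.
exact: (measurable_int mu (integrable_norm ih)).
Qed.

(** On the negative half-line the segment is empty and the integral is 0; on each [0, k] the
    primitive is continuous. These countably many pieces cover the line. *)
Lemma measurable_Rintegral_segment h :
  (forall T, 0 <= T -> mu.-integrable `[0, T] (EFin \o h)) ->
  measurable_fun setT (fun t => \int[mu]_(r in `[0, t]) h r).
Proof.
move=> ih.
have -> : [set: R] = [set` `]-oo, 0[] `|` \bigcup_(k : nat) [set` `[0, k%:R]].
  apply/seteqP; split=> // x _.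
  have [x0|x0] := ltP x 0; [left|right]; first by rewrite /= in_itv.
  exists (Num.truncn x).+1 => //=; rewrite in_itv/= x0 ltW//.
  exact: truncnS_gt.
apply/measurable_funU => //; first exact: bigcup_measurable.
split.
  apply: (@eq_measurable_fun _ _ _ _ _ (fun=> 0 : R)) => [x|]; last exact:
    measurable_cst.
  rewrite inE/= in_itv/= => x0; rewrite set_itv_ge ?Rintegral_set0//.
  by rewrite bnd_simp -ltNge.
apply/measurable_fun_bigcup => // k.
apply: subspace_continuous_measurable_fun => //.
exact: parameterized_integral_continuous (ih _ _).
Qed.

Lemma continuous_expRM (l : R) : continuous (fun s => expR (l * s)).
Proof.
move=> s; apply: (@continuous_comp _ _ _ ( *%R l) expR).
  exact: mulrl_continuous.
exact: continuous_expR.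
Qed.

Lemma integrable_expRM (l c t : R) :
  mu.-integrable `[0, t] (EFin \o (fun s => c * expR (l * s))).
Proof.
apply: continuous_compact_integrable; first exact: segment_compact.
apply: continuous_subspaceT => s.
exact: (continuousM (@cst_continuous _ _ c s) (@continuous_expRM l s)).
Qed.

Lemma Rintegral_expRM (l t : R) : 0 <= t ->
  \int[mu]_(s in `[0, t]) (l * expR (l * s)) = expR (l * t) - 1.
Proof.
rewrite le_eqVlt => /predU1P[<-|t0].
  by rewrite set_itv1 Rintegral_set1 mulr0 expR0 subrr.
rewrite /Rintegral (@continuous_FTC2 _ _ (fun s => expR (l * s)))//.
- by rewrite mulr0 expR0.
- apply: continuous_subspaceT => s.
  exact: (continuousM (@cst_continuous _ _ l s) (@continuous_expRM l s)).
- split.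
  + move=> s _; exact: ex_derive.
  + apply: cvg_at_right_filter; exact: continuous_expRM.
  + apply: cvg_at_left_filter; exact: continuous_expRM.
- move=> s _; rewrite derive1E derive_val.
  by rewrite /GRing.scale/= mulr1 mulrC.
Qed.

(** The bound on h is the derivative of C e^(ls), so integration reproduces the exponential weight
    of the Picard norm. *)
Lemma normr_Rintegral_le_expR h (l C t : R) : 0 <= t -> 0 <= C ->
  mu.-integrable `[0, t] (EFin \o h) ->
  (forall s, 0 <= s <= t -> `|h s| <= C * (l * expR (l * s))) ->
  `|\int[mu]_(s in `[0, t]) h s| <= C * expR (l * t).
Proof.
move=> t0 C0 ih Hh; apply: (le_trans (le_normr_Rintegral _ ih)) => //.
have ie : mu.-integrable `[0, t] (EFin \o (fun s => l * expR (l * s))).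
  exact: integrable_expRM.
have : \int[mu]_(s in `[0, t]) `|h s| <= \int[mu]_(s in `[0, t]) (C * (l * expR
  (l * s))).
  apply: le_Rintegral => //.
  - exact: integrable_norm.
  - by apply: eq_integrable (integrableZl _ C ie).
move=> /le_trans; apply; rewrite RintegralZl// Rintegral_expRM//.
by rewrite ler_wpM2l// lerBlDr lerDl.
Qed.

(** With r k = 2 C 2^-k, the sum of the increment bounds from k on, a - r is nondecreasing and a + r
    is nonincreasing. Both converge to the same limit, which lies within r k of a k. *)
Lemma geometric_increments_cvg (a : R^nat) (C : R) :
  (forall k, `|a k.+1 - a k| <= C * 2^-1 ^+ k) ->
  exists2 l, a @ \oo --> l & forall k, `|a k - l| <= 2 * C * 2^-1 ^+ k.
Proof.
move=> Ha; pose r k : R := 2 * C * 2^-1 ^+ k.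
have rS k : r k - r k.+1 = C * 2^-1 ^+ k by rewrite /r exprS; field.
have C0 : 0 <= C by have := Ha 0%N; rewrite expr0 mulr1; apply: le_trans.
have r0 k : 0 <= r k by rewrite /r !mulr_ge0// exprn_ge0// invr_ge0.
have ndb : nondecreasing_seq (a \- r).
  apply/nondecreasing_seqP => k /=; have := Ha k; rewrite -rS ler_norml; lra.
have nic : nonincreasing_seq (a \+ r).
  apply/nonincreasing_seqP => k /=; have := Ha k; rewrite -rS ler_norml; lra.
have ubb : has_ubound (range (a \- r)).
  exists (a 0%N + r 0%N) => _ [k _ <-] /=.
  by rewrite (le_trans _ (nic 0%N k isT))//= lerD2l ge0_cp.
have cb := nondecreasing_is_cvgn ndb ubb.
have rcv : r @ \oo --> (0 : R).
  apply: (@cvg_geometric R (2 * C) 2^-1).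
  by rewrite ger0_norm ?invr_ge0// invf_lt1 ?ltr1n.
set l := limn (a \- r) in cb.
have acv : a @ \oo --> l.
  have -> : a = (a \- r) \+ r by apply/funext => k /=; rewrite subrK.
  by rewrite -[l]addr0; apply: cvgD.
have ccv : (a \+ r) @ \oo --> l by rewrite -[l]addr0; apply: cvgD.
exists l => // k; rewrite ler_norml.
have /= := nondecreasing_cvgn_le ndb cb k; rewrite -/l.
have := @nonincreasing_cvgn_ge _ _ nic (cvgP _ ccv) k; rewrite (cvg_lim _
  ccv)//= -/(r k).
move=> h1 h2; apply/andP; split; lra.
Qed.

End integral_on_segments.

(** * Picard iteration for a right-hand side Lipschitz in the state and integrable in time *)

Section picard.
Context {R : realType} {n : nat}.
Local Notation mu := (@lebesgue_measure R).
Variable g : R -> 'cV[R]_n -> 'cV[R]_n.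
Variable L : R.
Hypothesis L_gt0 : 0 < L.
Hypothesis g_lip : forall s x y, `|g s x - g s y| <= L * `|x - y|.
Hypothesis g_meas : forall u : R -> 'cV[R]_n,
  (forall i, measurable_fun setT (fun t => u t i ord0)) ->
  forall i, measurable_fun setT (fun t => g t (u t) i ord0).
Hypothesis g_int : forall T, 0 <= T -> forall i,
  mu.-integrable `[0, T] (fun s => (g s 0 i ord0)%:E).
Variable x0 : 'cV[R]_n.
Implicit Types (u v : R -> 'cV[R]_n) (s t T B : R).

Definition integrable_rhs u t := forall i,
  mu.-integrable `[0, t] (fun s => (g s (u s) i ord0)%:E).

Definition picard_op u t : 'cV[R]_n :=
  \col_i (x0 i ord0 + \int[mu]_(s in `[0, t]) g s (u s) i ord0).

(** The weight grows at rate 2L: since L B e^(2Ls) = (B/2) (2L e^(2Ls)), the Lipschitz bound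
    integrates to half of the original constant. *)
Lemma picard_contraction u v B t : 0 <= t -> 0 <= B ->
  integrable_rhs u t -> integrable_rhs v t ->
  (forall s, 0 <= s <= t -> `|u s - v s| <= B * expR (2 * L * s)) ->
  `|picard_op u t - picard_op v t| <= B * 2^-1 * expR (2 * L * t).
Proof.
move=> t0 B0 iu iv Huv; have B2 : 0 <= B * 2^-1 by rewrite mulr_ge0.
apply: normr_mx_le => [|i j]; first by rewrite mulr_ge0// expR_ge0.
rewrite /picard_op !mxE opprD addrACA subrr add0r -RintegralB//; [|exact:
  iu|exact: iv].
apply: normr_Rintegral_le_expR => //.
  by apply: eq_integrable (integrableB _ (iu i) (iv i)).
move=> s /Huv Hs.
have : `|g s (u s) i ord0 - g s (v s) i ord0| <= `|g s (u s) - g s (v s)|.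
  by have := ler_coord_normr (g s (u s) - g s (v s)) i ord0; rewrite !mxE.
move=> /le_trans; apply; apply: (le_trans (g_lip _ _ _)).
apply: (le_trans (ler_wpM2l (ltW L_gt0) Hs)).
have -> : L * (B * expR (2 * L * s)) = B * 2^-1 * (2 * L * expR (2 * L * s)) by
  field.
by [].
Qed.

Lemma carath_solution_bounded u T :
  (forall t, 0 <= t -> integrable_rhs u t /\ u t = picard_op u t) -> 0 <= T ->
  exists2 B, 0 <= B & forall t, 0 <= t <= T -> `|u t| <= B.
Proof.
move=> Hu T0; have [iu _] := Hu T T0.
exists (\sum_i (`|x0 i ord0| + \int[mu]_(s in `[0, T]) `|g s (u s) i ord0|)).
  by apply: sumr_ge0 => i _; rewrite addr_ge0// Rintegral_ge0.
move=> t /andP[t0 tT]; have [_ ->] := Hu t t0.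
apply: (le_trans (normr_cV_le_sum _)); apply: ler_sum => i _.
rewrite mxE (le_trans (ler_normD _ _))// lerD2l.
apply: le_normr_Rintegral_segment => //; exact: iu.
Qed.

(** Both solutions are bounded on [0, T], which starts an induction in which each use of the
    integral equation halves the weighted distance. *)
Lemma carath_solution_unique u v :
  (forall t, 0 <= t -> integrable_rhs u t /\ u t = picard_op u t) ->
  (forall t, 0 <= t -> integrable_rhs v t /\ v t = picard_op v t) ->
  forall t, 0 <= t -> u t = v t.
Proof.
move=> Hu Hv T T0.
have [B B0 HB] := carath_solution_bounded Hu T0.
have [C C0 HC] := carath_solution_bounded Hv T0.
have Hk (k : nat) t : 0 <= t <= T ->
    `|u t - v t| <= (B + C) * 2^-1 ^+ k * expR (2 * L * t).
  elim: k t => [|k IH] t /andP[t0 tT].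
    rewrite expr0 mulr1 (le_trans (ler_normB _ _))//.
    have BC : `|u t| + `|v t| <= B + C by rewrite lerD ?HB ?HC ?t0.
    rewrite (le_trans BC)// ler_peMr ?addr_ge0// -expR0 ler_expR.
    by rewrite mulr_ge0// mulr_ge0// ltW.
  have [[iu ->] [iv ->]] := (Hu t t0, Hv t t0).
  rewrite exprSr mulrA; apply: picard_contraction => //.
    by rewrite mulr_ge0 ?addr_ge0// exprn_ge0// invr_ge0.
  by move=> s /andP[s0 st]; apply: IH; rewrite s0 (le_trans st).
apply/eqP; rewrite -subr_eq0 -normr_le0.
apply: (@le0_of_le_geometric _ _ ((B + C) * expR (2 * L * T))) => k.
by rewrite mulrAC Hk// T0 lexx.
Qed.

(** A class that [picard_op] preserves and on which the right-hand side is integrable. Negative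
    times are included, so that measurability can be stated on the whole line. *)
Definition admissible u := (forall i, measurable_fun setT (fun t => u t i
  ord0)) /\
  forall T, exists2 B, 0 <= B & forall t, t <= T -> `|u t| <= B.

Lemma normr_rhs_le u B s i : `|u s| <= B ->
  `|g s (u s) i ord0| <= `|g s 0 i ord0| + L * B.
Proof.
move=> uB; rewrite -lerBlDl (le_trans (lerB_dist _ _))//.
have := ler_coord_normr (g s (u s) - g s 0) i ord0; rewrite !mxE => /le_trans;
  apply.
by rewrite (le_trans (g_lip _ _ _))// subr0 ler_wpM2l// ltW.
Qed.

Lemma integrable_dominator B T i : 0 <= T ->
  mu.-integrable `[0, T] (fun s => (`|g s 0 i ord0| + L * B)%:E).
Proof.
move=> T0; have /integrable_norm ig := g_int T0 i.
exact: eq_integrable (integrableD _ ig (integrable_cst_segment 0 T (L * B))).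
Qed.

Lemma integrable_rhs_admissible u T : 0 <= T -> admissible u -> integrable_rhs
  u T.
Proof.
move=> T0 [mu_ bu] i; have [B B0 HB] := bu T.
apply: le_integrable (integrable_dominator B i T0) => //.
  apply/measurable_EFinP; apply: measurable_funTS; exact: g_meas.
move=> s /=; rewrite in_itv/= => /andP[s0 sT]; rewrite lee_fin.
rewrite [leRHS]ger0_norm ?addr_ge0 ?mulr_ge0// ?(ltW L_gt0)//.
by apply: normr_rhs_le; exact: HB.
Qed.

Lemma admissible_picard_op u : admissible u -> admissible (picard_op u).
Proof.
move=> au; have iu T (T0 : 0 <= T) := integrable_rhs_admissible T0 au.
split=> [i|T].
  have -> : (fun t => picard_op u t i ord0) =
      (fun t => x0 i ord0 + \int[mu]_(s in `[0, t]) g s (u s) i ord0).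
    by apply/funext => t; rewrite mxE.
  apply: measurable_funD; first exact: measurable_cst.
  by apply: measurable_Rintegral_segment => T T0; exact: iu.
(* T may be negative, whereas the dominating integral needs a horizon that is at least 0. *)
pose T' := Num.max T 0; have T'0 : 0 <= T' by rewrite le_max lexx orbT.
exists (\sum_i (`|x0 i ord0| + \int[mu]_(s in `[0, T']) `|g s (u s) i ord0|)).
  by apply: sumr_ge0 => i _; rewrite addr_ge0// Rintegral_ge0.
move=> t tT; apply: (le_trans (normr_cV_le_sum _)); apply: ler_sum => i _.
rewrite mxE (le_trans (ler_normD _ _))// lerD2l.
by apply: le_normr_Rintegral_segment; rewrite ?le_max ?tT//; exact: iu.
Qed.

Definition picard_iter k : R -> 'cV[R]_n := iter k picard_op (fun=> x0).

Lemma admissible_picard_iter k : admissible (picard_iter k).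
Proof.
elim: k => [|k IH]; last exact: admissible_picard_op.
by split=> [i|T]; [exact: measurable_cst|exists `|x0|].
Qed.

Lemma picard_op_lt0 u t : t < 0 -> picard_op u t = x0.
Proof.
move=> t0; apply/colP => i; rewrite mxE set_itv_ge ?Rintegral_set0 ?addr0//.
by rewrite bnd_simp -ltNge.
Qed.

Lemma picard_iter_increment T : 0 <= T -> exists2 C, 0 <= C &
  forall k t, t <= T -> `|picard_iter k.+1 t - picard_iter k t| <= C * 2^-1 ^+
    k.
Proof.
move=> T0.
have [B B0 HB] := (admissible_picard_iter 1).2 T.
pose E s := expR (2 * L * s).
have E1 s : 0 <= s -> 1 <= E s.
  by move=> s0; rewrite -expR0 ler_expR !mulr_ge0// ltW.
have D0 : 0 <= B + `|x0| by rewrite addr_ge0.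
have Hk k t : 0 <= t <= T ->
    `|picard_iter k.+1 t - picard_iter k t| <= (B + `|x0|) * 2^-1 ^+ k * E t.
  elim: k t => [|k IH] t /andP[t0 tT].
    rewrite expr0 mulr1 (le_trans (ler_normB _ _))//.
    have BC : `|picard_iter 1 t| + `|picard_iter 0 t| <= B + `|x0| by rewrite
      lerD ?HB.
    by rewrite (le_trans BC)// ler_peMr// E1.
  rewrite exprSr mulrA; apply: picard_contraction => //.
  - by rewrite mulr_ge0// exprn_ge0// invr_ge0.
  - exact: (integrable_rhs_admissible t0 (admissible_picard_iter k.+1)).
  - exact: (integrable_rhs_admissible t0 (admissible_picard_iter k)).
  - by move=> s /andP[s0 st]; apply: IH; rewrite s0 (le_trans st).
exists ((B + `|x0|) * E T); first by rewrite mulr_ge0// expR_ge0.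
move=> k t tT; have P0 : 0 <= (B + `|x0|) * 2^-1 ^+ k :> R.
  by rewrite mulr_ge0// exprn_ge0// invr_ge0.
(* At negative times every iterate equals [x0], so the increment vanishes. *)
have [t0|t0] := ltP t 0.
  have -> : picard_iter k.+1 t = x0 by exact: picard_op_lt0.
  have -> : picard_iter k t = x0 by case: k {P0} => // k; exact: picard_op_lt0.
  by rewrite subrr normr0 mulrAC mulr_ge0// expR_ge0.
rewrite (le_trans (Hk k t _)) ?t0// [leRHS]mulrAC ler_wpM2l//.
by rewrite ler_expR ler_wpM2l// mulr_ge0// ltW.
Qed.

(** The pointwise limit of the iterates is measurable, and bounded on each half-line because
    convergence is uniform there. It is a fixed point because the iterates come arbitrarily close
    both to it and to its image. *)
Lemma carath_solution_exists : exists u,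
  [/\ forall i, measurable_fun setT (fun t => u t i ord0),
      forall T, exists2 B, 0 <= B & forall t, t <= T -> `|u t| <= B &
      forall t, 0 <= t -> integrable_rhs u t /\ u t = picard_op u t].
Proof.
pose u t : 'cV[R]_n := \col_i limn (fun k => picard_iter k t i ord0).
have cvu T : 0 <= T -> exists2 C, 0 <= C & forall t, t <= T ->
    (forall i, (fun k => picard_iter k t i ord0) @ \oo --> u t i ord0) /\
    forall k, `|picard_iter k t - u t| <= 2 * C * 2^-1 ^+ k.
  move=> T0; have [C C0 HC] := picard_iter_increment T0.
  exists C => // t tT.
  have Hi i : (fun k => picard_iter k t i ord0) @ \oo --> u t i ord0 /\
      forall k, `|picard_iter k t i ord0 - u t i ord0| <= 2 * C * 2^-1 ^+ k.
    have [|l cl Hl] := @geometric_increments_cvg _ (fun k => picard_iter k t i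
      ord0) C.
      move=> k; apply: le_trans (HC k t tT).
      have := ler_coord_normr (picard_iter k.+1 t - picard_iter k t) i ord0.
      by rewrite !mxE.
    by rewrite mxE (cvg_lim _ cl).
  split=> [i|k]; first by have [] := Hi i.
  apply: normr_mx_le => [|i j].
    by rewrite !mulr_ge0// exprn_ge0// invr_ge0.
  by rewrite ord1 !mxE; have [_] := Hi i; rewrite mxE.
have au : admissible u.
  split=> [i|T].
    apply: (@measurable_fun_cvg _ _ _ setT (fun k t => picard_iter k t i ord0))
      => [k|t _].
      by have [] := admissible_picard_iter k.
    have [C _ /(_ t)[]] := cvu _ (normr_ge0 t); first exact: ler_norm.
    by move=> + _; exact.
  have T0 : 0 <= Num.max T 0 by rewrite le_max lexx orbT.
  have [C C0 HC] := cvu _ T0.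
  exists (`|x0| + 2 * C) => [|t tT]; first by rewrite addr_ge0// mulr_ge0.
  have [|_ /(_ 0%N)] := HC t; first by rewrite le_max tT.
  rewrite expr0 mulr1 => Hd.
  have -> : u t = x0 - (picard_iter 0 t - u t) by rewrite opprB addrC subrK.
  by rewrite (le_trans (ler_normB _ _))// lerD2l.
exists u; have [mu_ bu] := au; split=> // t t0.
have iu := integrable_rhs_admissible t0 au; split=> //.
apply/eqP; rewrite -subr_eq0 -normr_le0.
have [C C0 HC] := cvu t t0.
apply: (@le0_of_le_geometric _ _ (C * (1 + expR (2 * L * t)))) => k.
(* The iterate k + 1 is inserted: it is within C 2^-k of u by the convergence rate, and within C
   2^-k e^(2Lt) of the image of u by contraction from the iterate k. *)
have -> : u t - picard_op u t =
    (picard_iter k.+1 t - picard_op u t) - (picard_iter k.+1 t - u t).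
  by rewrite opprB [RHS]addrC addrA subrK.
apply: (le_trans (ler_normB _ _)).
have : `|picard_iter k.+1 t - u t| <= C * 2^-1 ^+ k.
  have [//|_ /(_ k.+1)] := HC t.
  by congr (_ <= _); rewrite exprS; field.
have : `|picard_iter k.+1 t - picard_op u t| <=
    (2 * C * 2^-1 ^+ k) * 2^-1 * expR (2 * L * t).
  have P0 : 0 <= 2 * C * 2^-1 ^+ k :> R.
    by rewrite !mulr_ge0// exprn_ge0// invr_ge0.
  apply: picard_contraction => //.
    exact/integrable_rhs_admissible/admissible_picard_iter.
  move=> s /andP[s0 st]; have [//|_ /(_ k) Hs] := HC s.
  apply: (le_trans Hs); rewrite ler_peMr// -expR0 ler_expR !mulr_ge0//.
  exact: ltW.
have -> : 2 * C * 2^-1 ^+ k * 2^-1 * expR (2 * L * t) =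
  C * expR (2 * L * t) * 2^-1 ^+ k by field.
rewrite mulrDr mulr1 mulrDl; lra.
Qed.

End picard.

(** * Energy estimates *)

Lemma integrable_sum_EFin d (X : measurableType d) (R : realType)
    (mu : {measure set X -> \bar R}) (I : Type) (r : seq I) (D : set X)
    (h : I -> X -> R) : measurable D ->
  (forall i, mu.-integrable D (EFin \o h i)) ->
  mu.-integrable D (EFin \o (fun x => \sum_(i <- r) h i x)).
Proof.
move=> mD ih; have := integrable_sum mD r (P := xpredT) (fun i _ => ih i).
by apply: eq_integrable => // x _; rewrite /= sumEFin.
Qed.

Lemma Rintegral_sum d (X : measurableType d) (R : realType)
    (mu : {measure set X -> \bar R}) (I : Type) (r : seq I) (D : set X)
    (h : I -> X -> R) : measurable D ->
  (forall i, mu.-integrable D (EFin \o h i)) ->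
  \int[mu]_(x in D) (\sum_(i <- r) h i x) = \sum_(i <- r) \int[mu]_(x in D) h i
    x.
Proof.
move=> mD ih; elim: r => [|i r IH].
  rewrite big_nil; under eq_Rintegral do rewrite big_nil.
  by rewrite Rintegral_cst// mul0r.
rewrite big_cons -IH -RintegralD//; last exact: integrable_sum_EFin.
by apply: eq_Rintegral => x _; rewrite big_cons.
Qed.

Section energy.
Context {R : realType} {n : nat}.
Local Notation mu := (@lebesgue_measure R).

Lemma bilin_form_coord_le (P : 'M[R]_n) (x y : 'cV[R]_n) (M : R) :
  (forall j, `|y j ord0| <= M) ->
  bilin_form P x y <= (\sum_i \sum_j `|P i j|) * (\sum_i `|x i ord0|) * M.
Proof.
move=> yM; rewrite bilin_formE (le_trans (ler_norm _))// -mulrA mulr_suml.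
rewrite (le_trans (ler_norm_sum _ _ _))//; apply: ler_sum => i _.
rewrite mulr_suml (le_trans (ler_norm_sum _ _ _))//; apply: ler_sum => j _.
rewrite -mulrA !normrM ler_wpM2l// ler_pM//.
by rewrite (bigD1 i)//= lerDl sumr_ge0.
Qed.

Variables (P : 'M[R]_n) (u h : R -> 'cV[R]_n) (phi : R -> R) (T : R).
Hypothesis P_sym : P^T = P.
Hypothesis T_ge0 : 0 <= T.
Hypothesis h_int : forall i, mu.-integrable `[0, T] (EFin \o (fun r => h r i
  ord0)).
Hypothesis u_prim : forall t, 0 <= t <= T -> forall i,
  u t i ord0 = u 0 i ord0 + \int[mu]_(r in `[0, t]) h r i ord0.
Hypothesis phi_int : mu.-integrable `[0, T] (EFin \o phi).
Hypothesis dissipation : forall r, 0 <= r <= T -> 2 * bilin_form P (h r) (u r)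
  <= phi r.

(** The increments of the primitive [G] of this l1 norm dominate those of every coordinate of u; [G]
    measures the length of a time interval in the bisection. *)
Let a r := \sum_i `|h r i ord0|.
Let G t := \int[mu]_(r in `[0, t]) a r.
Let Phi t := \int[mu]_(r in `[0, t]) phi r.

Let a_int : mu.-integrable `[0, T] (EFin \o a).
Proof. by apply: integrable_sum_EFin => // i; exact: integrable_norm (h_int i).
  Qed.

Let integrable_itvoc f s t : 0 <= s -> t <= T ->
  mu.-integrable `[0, T] (EFin \o f) -> mu.-integrable `]s, t] (EFin \o f).
Proof.
move=> s0 tT; apply: integrableS => //.
by apply: subset_itv => //; rewrite bnd_simp.
Qed.

Let Rintegral_itvoc f s t : 0 <= s -> s <= t -> t <= T ->
  mu.-integrable `[0, T] (EFin \o f) ->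
  \int[mu]_(r in `]s, t]) f r =
  \int[mu]_(r in `[0, t]) f r - \int[mu]_(r in `[0, s]) f r.
Proof.
move=> s0 st tT fi; rewrite Rintegral_segment_itvoc//.
exact: integrable_segmentS fi.
Qed.

Let increment s t i : 0 <= s -> s <= t -> t <= T ->
  u t i ord0 - u s i ord0 = \int[mu]_(r in `]s, t]) h r i ord0.
Proof.
move=> s0 st tT; rewrite (Rintegral_itvoc s0 st tT (h_int i)).
rewrite u_prim ?(le_trans s0)// [in X in _ - X]u_prim ?s0 ?(le_trans st)//.
by rewrite opprD addrACA subrr add0r.
Qed.

Let increment_le s t i : 0 <= s -> s <= t -> t <= T ->
  `|u t i ord0 - u s i ord0| <= G t - G s.
Proof.
move=> s0 st tT; rewrite increment// /G -Rintegral_itvoc//.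
have ihi := integrable_itvoc s0 tT (h_int i).
rewrite (le_trans (le_normr_Rintegral _ ihi))//.
apply: le_Rintegral => //.
- exact: integrable_norm ihi.
- exact: integrable_itvoc.
- by move=> r _; rewrite /a (bigD1 i)//= lerDl sumr_ge0.
Qed.

Let G_nondecreasing s t : 0 <= s -> s <= t -> t <= T -> G s <= G t.
Proof.
move=> s0 st tT; rewrite -subr_ge0 /G -Rintegral_itvoc//.
by apply: Rintegral_ge0 => r _; exact: sumr_ge0.
Qed.

Let C := 2 * (\sum_i \sum_j `|P i j|).

(** By symmetry the increment is the form at u(t) - u(s) and w = u(t) + u(s), that is, the integral
    of the form at h(r) and the fixed vector w. Replacing w by 2 u(r) brings in the dissipation
    bound, with an error of at most C D a(r), which integrates to C D^2. *)
Lemma quad_form_increment_le s t : 0 <= s -> s <= t -> t <= T ->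
  quad_form P (u t) - quad_form P (u s) <=
    Phi t - Phi s + C * (G t - G s) ^+ 2.
Proof.
move=> s0 st tT; rewrite quad_form_sub_eq//.
set w := u t + u s; set D := G t - G s.
pose c i := \sum_j P i j * w j ord0.
have bE x : bilin_form P x w = \sum_i c i * x i ord0.
  rewrite bilin_formE; apply: eq_bigr => i _; rewrite mulr_suml.
  by apply: eq_bigr => j _; rewrite mulrAC.
have ih i := integrable_itvoc s0 tT (h_int i).
have ich i : mu.-integrable `]s, t] (EFin \o (fun r => c i * h r i ord0)).
  by apply: eq_integrable (integrableZl _ (c i) (ih i)).
have -> : bilin_form P (u t - u s) w = \int[mu]_(r in `]s, t]) bilin_form P (h
  r) w.
  rewrite bE; under eq_Rintegral do rewrite bE.
  rewrite Rintegral_sum//; apply: eq_bigr => i _.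
  by rewrite RintegralZl// !mxE increment.
have iD : mu.-integrable `]s, t] (EFin \o (fun r => C * D * a r)).
  by apply: eq_integrable (integrableZl _ (C * D) (integrable_itvoc s0 tT
    a_int)).
have -> : Phi t - Phi s + C * D ^+ 2 =
    \int[mu]_(r in `]s, t]) (phi r + C * D * a r).
  rewrite RintegralD//; last exact: integrable_itvoc.
  rewrite RintegralZl//; last exact: integrable_itvoc.
  by rewrite !Rintegral_itvoc// expr2 -/(G t) -/(G s) -/D mulrA.
apply: le_Rintegral => //.
- have := @integrable_sum_EFin _ _ _ mu _ (index_enum 'I_n) `]s, t] _
  (measurable_itv _) ich.
  by apply: eq_integrable => // r _; rewrite /= bE.
- by apply: eq_integrable (integrableD _ (integrable_itvoc s0 tT phi_int) iD).
move=> r /=; rewrite in_itv/= => /andP[sr rt].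
have r0 : 0 <= r := le_trans s0 (ltW sr).
(* Each coordinate of the last two differences is at most D in absolute value, since r lies between
   s and t. *)
have -> : w = 2 *: u r + (u t - u r) + (u s - u r).
  by apply/colP => i; rewrite !mxE; ring.
rewrite bilin_formDr (bilin_formDr _ _ (2 *: u r)) bilin_formZr -addrA lerD//.
  by apply: dissipation; rewrite r0 (le_trans rt).
have -> : C * D * a r = (\sum_i \sum_j `|P i j|) * a r * D +
     (\sum_i \sum_j `|P i j|) * a r * D by rewrite /C; ring.
have rT := le_trans rt tT.
have GD1 : G t - G r <= D.
  by rewrite /D lerD2l lerN2; exact: G_nondecreasing s0 (ltW sr) rT.
have GD2 : G r - G s <= D by rewrite /D lerD2r; exact: G_nondecreasing.
apply: lerD; apply: bilin_form_coord_le => j; rewrite !mxE.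
  by apply: le_trans GD1; apply: increment_le.
by rewrite distrC; apply: le_trans GD2; apply: increment_le => //; exact: ltW.
Qed.

(* Halving the increment of G divides its square by 4, so bisecting [s, t] at
   the G-midpoint halves the error term of quad_form_increment_le. *)
Lemma energy_inequality :
  quad_form P (u T) <= quad_form P (u 0) + Phi T.
Proof.
pose Z t := quad_form P (u t) - Phi t.
have Hk k s t : 0 <= s -> s <= t -> t <= T ->
    Z t - Z s <= C * (G t - G s) ^+ 2 * 2^-1 ^+ k.
  elim: k s t => [|k IH] s t s0 st tT.
    rewrite expr0 mulr1; have := quad_form_increment_le s0 st tT; rewrite /Z;
      lra.
  have cG : {within `[s, t], continuous G}.
    apply: continuous_subspaceW (parameterized_integral_continuous T_ge0 a_int).
    by apply: subset_itv; rewrite bnd_simp.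
  have Gst := G_nondecreasing s0 st tT.
  have [|r rst Gr] := @IVT _ G s t ((G s + G t) / 2) st cG.
    by rewrite ge_min le_max; apply/andP; split; apply/orP; [left|right]; lra.
  move: rst; rewrite in_itv/= => /andP[sr rt].
  have := IH s r s0 sr (le_trans rt tT); have := IH r t (le_trans s0 sr) rt tT.
  have -> : G t - G r = 2^-1 * (G t - G s) by rewrite Gr; field.
  have -> : G r - G s = 2^-1 * (G t - G s) by rewrite Gr; field.
  rewrite exprMn (exprSr _ k); move: (_ ^+ k) ((G t - G s) ^+ 2) => q g.
  have -> : C * (2^-1 ^+ 2 * g) * q = C * g * (q * 2^-1) * 2^-1 by field.
  lra.
have : Z T - Z 0 <= 0.
  by apply: (@le0_of_le_geometric _ _ (C * (G T - G 0) ^+ 2)) => k; exact: Hk.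
rewrite /Z /Phi set_itv1 Rintegral_set1; lra.
Qed.

End energy.

(** * Measurability of continuous functions of measurable vector signals *)

Section measurable_composition.
Context {R : realType}.

(** An open set is the union of the countably many cubes with rational centre and radius that it
    contains, and the preimage of a cube is a finite intersection of coordinate conditions. *)
Lemma open_cV_preimage_measurable d (X : measurableType d) n (u : X ->
  'cV[R]_n) (O : set 'cV[R]_n) :
  (forall i, measurable_fun setT (fun t => u t i ord0)) -> open O ->
  measurable (u @^-1` O).
Proof.
move=> mu_ oO.
pose box (c : 'cV[rat]_n * rat) : set 'cV[R]_n :=
  [set x | forall i, `|x i ord0 - ratr (c.1 i ord0)| < ratr c.2].
have OE : O = \bigcup_(c in [set c | box c `<=` O]) box c.
  apply/seteqP; split=> [x Ox|x [c cO /cO]//].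
  have /nbhs_ballP[e /= e0 eO] := oO x Ox.
  (* A cube of radius q that contains x lies within distance 2q of x, hence inside the ball of
     radius e. *)
  have [q] := @rat_in_itvoo R 0 (e / 2) (divr_gt0 e0 (ltr0n _ 2)).
  rewrite in_itv/= => /andP[q0 qe].
  have Hc i : exists c : rat, `|x i ord0 - ratr c| < ratr q.
    have [|c] := @rat_in_itvoo R (x i ord0) (x i ord0 + ratr q); first by
      rewrite ltrDl.
    by rewrite in_itv/= => /andP[? ?]; exists c; rewrite ltr_norml; apply/andP;
      split; lra.
  have [c Hcq] := choice Hc.
  exists (\col_i c i, q) => /= [y /= Hy|i]; last by rewrite mxE.
  apply: eO; rewrite -ball_normE /ball_/=.
  apply: le_lt_trans (_ : 2 * ratr q < e); last lra.
  apply: normr_mx_le => [|i j]; first lra.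
  rewrite ord1; have := Hy i; have := Hcq i; rewrite !mxE !ltr_norml ler_norml.
  by move=> /andP[? ?] /andP[? ?]; apply/andP; split; lra.
rewrite OE preimage_bigcup bigcup_mkcond.
apply: countable_bigcupT_measurable => [|c]; first exact: countableP.
case: ifPn => // _.
have -> : u @^-1` box c =
    \bigcap_(i : 'I_n) ((fun t => u t i ord0) @^-1`
      [set` `]ratr (c.1 i ord0) - ratr c.2, ratr (c.1 i ord0) + ratr c.2[]).
  apply/seteqP; split=> [t /= Ht i _|t /= Ht i].
    by rewrite /= in_itv/= -ltr_distl; exact: Ht.
  by have := Ht i I; rewrite /= in_itv/= -ltr_distl.
apply: fin_bigcap_measurable => // i _.
by rewrite -[X in measurable X]setTI; apply: (mu_ i).
Qed.

Lemma measurable_comp_cV d (X : measurableType d) n (f : 'cV[R]_n -> R) (u : X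
  -> 'cV[R]_n) :
  continuous f ->
  (forall i, measurable_fun setT (fun t => u t i ord0)) ->
  measurable_fun setT (f \o u).
Proof.
move=> cf mu_; apply: (measurability _ (RGenOpens.measurableE R)).
move=> _ [_ [a [b ->] <-]]; rewrite setTI comp_preimage.
apply: open_cV_preimage_measurable => //.
by apply: open_comp; [move=> x _; exact: cf|exact: interval_open].
Qed.

(** Stacking the two signals into one column reduces the claim to a function of a single vector. *)
Lemma measurable_comp_cV2 d (X : measurableType d) n k q
    (f : 'cV[R]_n * 'cV[R]_k -> 'cV[R]_q) (u : X -> 'cV[R]_n) (v : X ->
      'cV[R]_k) :
  continuous f ->
  (forall i, measurable_fun setT (fun t => u t i ord0)) ->
  (forall i, measurable_fun setT (fun t => v t i ord0)) ->
  forall i, measurable_fun setT (fun t => f (u t, v t) i ord0).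
Proof.
move=> cf mu_ mv i.
pose F (z : 'cV[R]_(n + k)) := f (usubmx z, dsubmx z) i ord0.
have -> : (fun t => f (u t, v t) i ord0) = F \o (fun t => col_mx (u t) (v t)).
  by apply/funext => t; rewrite /F /= col_mxKu col_mxKd.
apply: measurable_comp_cV => [z|j]; last first.
  case: (split_ordP j) => l ->.
    rewrite (_ : (fun t => _) = (fun t => u t l ord0)); first exact: mu_.
    by apply/funext => t; rewrite col_mxEu.
  rewrite (_ : (fun t => _) = (fun t => v t l ord0)); first exact: mv.
  by apply/funext => t; rewrite col_mxEd.
apply: (@continuous_comp _ _ _ (fun z => f (usubmx z, dsubmx z)) (fun y :
  'cV[R]_q => y i ord0)).
  apply: (@continuous_comp _ _ _ (fun z => (usubmx z, dsubmx z)) f); last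
    exact: cf.
  have cu : continuous (usubmx : 'cV[R]_(n + k) -> 'cV[R]_n).
    have -> : usubmx = (fun z : 'cV[R]_(n + k) => usubmx 1%:M *m z).
      by apply/funext => y; rewrite mul_usub_mx mul1mx.
    exact: mulmx_continuous.
  have cd : continuous (dsubmx : 'cV[R]_(n + k) -> 'cV[R]_k).
    have -> : dsubmx = (fun z : 'cV[R]_(n + k) => dsubmx 1%:M *m z).
      by apply/funext => y; rewrite mul_dsub_mx mul1mx.
    exact: mulmx_continuous.
  exact: (cvg_pair (cu z) (cd z)).
exact: coord_continuous.
Qed.

End measurable_composition.

(** * Input-output maps of Lipschitz systems *)

Section lipschitz_system.
Context {R : realType} {p k : nat}.
Local Notation mu := (@lebesgue_measure R).

Lemma sqr_normr_le_sqnorm2 n (x : 'cV[R]_n) : `|x| ^+ 2 <= sqnorm2 x.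
Proof.
rewrite -[leRHS]sqr_sqrtr ?sqnorm2_ge0// ler_pXn2r ?nnegrE ?sqrtr_ge0//.
apply: normr_mx_le => [|i j]; first exact: sqrtr_ge0.
by rewrite ord1 -sqrtr_sqr ler_wsqrtr// ler_coord_sqnorm2.
Qed.

Lemma sqnorm2_le_sqr_normr n (x : 'cV[R]_n) : sqnorm2 x <= n%:R * `|x| ^+ 2.
Proof.
rewrite -[X in X%:R]card_ord -sum1_card natr_sum mulr_suml; apply: ler_sum => i
  _.
by rewrite mul1r -real_normK ?num_real// ler_pXn2r ?nnegrE// ler_coord_normr.
Qed.

Lemma measurable_sqnorm2 d (X : measurableType d) n (u : X -> 'cV[R]_n) :
  (forall i, measurable_fun setT (fun t => u t i ord0)) ->
  measurable_fun setT (fun t => sqnorm2 (u t)).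
Proof.
by move=> mu_; apply: measurable_sum => i; apply: measurable_funX.
Qed.

Lemma L2e_sub_integrable n (w w' : R -> 'cV[R]_n) T : L2e w -> L2e w' -> 0 < T
  ->
  mu.-integrable `[0, T] (EFin \o (fun t => sqnorm2 (w t - w' t))).
Proof.
move=> [mw _ iw] [mw' _ iw'] T0.
have i1 := integrableZl (mu := mu) (measurable_itv _) 2 (iw T T0).
have i2 := integrableZl (mu := mu) (measurable_itv _) 2 (iw' T T0).
have md : measurable_fun setT (fun t => sqnorm2 (w t - w' t)).
  apply: measurable_sqnorm2 => i; under eq_fun do rewrite !mxE.
  by apply: measurable_funB; [exact: mw|exact: mw'].
apply: le_integrable (integrableD _ i1 i2) => //.
  by apply/measurable_EFinP; apply: measurable_funTS; exact: md.
move=> t _ /=; rewrite lee_fin !ger0_norm ?addr_ge0 ?mulr_ge0 ?sqnorm2_ge0//.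
by rewrite (le_trans (sqnorm2D_le _ _))// sqnorm2N.
Qed.

Variable phi : 'cV[R]_p * 'cV[R]_k -> 'cV[R]_p.
Variable a : R.
Hypothesis a_gt0 : 0 < a.
Hypothesis phi_cont : continuous phi.
Hypothesis phi_growth : forall x x' w w',
  sqnorm2 (phi (x, w) - phi (x', w')) <= a * (sqnorm2 (x - x') + sqnorm2 (w -
    w')).

Let f (x : 'cV[R]_p) (w : 'cV[R]_k) := - phi (x, w).
Let g (x : 'cV[R]_p) (w : 'cV[R]_k) := phi (x, w).
Implicit Types (w : R -> 'cV[R]_k) (eta : R -> 'cV[R]_p) (x : 'cV[R]_p).

(** A Lipschitz constant for the max norm: the factor p comes from the passage to the Euclidean
    norm, and the 1 gives positivity and a p <= L^2. *)
Let L := 1 + a * p%:R.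

Let L_gt0 : 0 < L.
Proof. by rewrite /L ltr_pwDl// mulr_ge0// ltW. Qed.

Let f_lip w s x y : `|f x (w s) - f y (w s)| <= L * `|x - y|.
Proof.
rewrite -(@ler_pXn2r _ 2) ?nnegrE ?mulr_ge0 ?(ltW L_gt0)//.
rewrite (le_trans (sqr_normr_le_sqnorm2 _))// /f -opprD sqnorm2N.
apply: (le_trans (phi_growth _ _ _ _)).
rewrite subrr sqnorm2_0 addr0 (le_trans (ler_wpM2l (ltW a_gt0)
  (sqnorm2_le_sqr_normr _)))//.
rewrite exprMn mulrA ler_wpM2r ?sqr_ge0//.
have : 0 <= a * p%:R by rewrite mulr_ge0// ltW.
rewrite /L; move: (a * _) => b b0; nra.
Qed.

Let phi_sqnorm2_le x (w : 'cV[R]_k) :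
  sqnorm2 (phi (x, w)) <= 2 * a * (sqnorm2 x + sqnorm2 w) + 2 * sqnorm2 (phi
    (0, 0)).
Proof.
have -> : phi (x, w) = (phi (x, w) - phi (0, 0)) + phi (0, 0) by rewrite subrK.
apply: (le_trans (sqnorm2D_le _ _)); rewrite lerD2r -mulrA ler_pM2l//.
by have := phi_growth x 0 w 0; rewrite !subr0.
Qed.

Let measurable_phi eta w :
  (forall i, measurable_fun setT (fun t => eta t i ord0)) -> L2e w ->
  forall i, measurable_fun setT (fun t => phi (eta t, w t) i ord0).
Proof. by move=> me [mw _ _]; exact: measurable_comp_cV2. Qed.

Let f_meas w : L2e w -> forall eta,
  (forall i, measurable_fun setT (fun t => eta t i ord0)) ->
  forall i, measurable_fun setT (fun t => f (eta t) (w t) i ord0).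
Proof.
move=> Lw eta me i.
rewrite (_ : (fun t => _) = (fun t => - phi (eta t, w t) i ord0)).
  by apply: measurableT_comp => //; exact: measurable_phi.
by apply/funext => t; rewrite mxE.
Qed.

Let integrable_affine_sqnorm2 w (A B T : R) : L2e w -> 0 < T ->
  mu.-integrable `[0, T] (EFin \o (fun s => A + B * sqnorm2 (w s))).
Proof.
move=> [_ _ iw] T0; have i1 := integrableZl (mu := mu) (measurable_itv _) B (iw
  T T0).
by apply: eq_integrable (integrableD _ (integrable_cst_segment 0 T A) i1).
Qed.

Let f_int w : L2e w -> forall T, 0 <= T -> forall i,
  mu.-integrable `[0, T] (fun s => (f 0 (w s) i ord0)%:E).
Proof.
move=> Lw T T0 i.
(* [L2e] gives integrability only for positive horizons, and T may be 0. *)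
have T1 : 0 < T + 1 by rewrite ltr_wpDl.
apply: (@integrable_segmentS _ (fun s => f 0 (w s) i ord0) T (T + 1)).
  by rewrite lerDl.
(* The 1 comes from y <= 1 + y^2, which turns the quadratic growth bound into a bound on the
   absolute value of one coordinate. *)
pose A := 1 + 2 * sqnorm2 (phi (0, 0)).
have A0 : 0 <= A by rewrite addr_ge0// mulr_ge0// sqnorm2_ge0.
apply: le_integrable (integrable_affine_sqnorm2 A (2 * a) Lw T1) => //.
  apply/measurable_EFinP/measurable_funTS.
  by apply: (f_meas Lw (eta := fun=> 0)) => j; exact: measurable_cst.
move=> s _ /=; rewrite lee_fin.
have B0 : 0 <= 2 * a * sqnorm2 (w s) by rewrite !mulr_ge0 ?sqnorm2_ge0// ltW.
have -> : f 0 (w s) i ord0 = - phi (0, w s) i ord0 by rewrite mxE.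
have -> : `|A + 2 * a * sqnorm2 (w s)| = A + 2 * a * sqnorm2 (w s).
  by rewrite ger0_norm// addr_ge0.
rewrite normrN.
have := phi_sqnorm2_le 0 (w s).
have := ler_coord_sqnorm2 (phi (0, w s)) i; rewrite -real_normK ?num_real//.
rewrite sqnorm2_0 add0r.
rewrite /A; move: `|_| (sqnorm2 (phi _)) (sqnorm2 (phi _)) B0 => y z z0 B0.
move: (2 * a * _) B0 => b b0; nra.
Qed.

Lemma ode_solutionP w x0 eta : ode_solution f x0 w eta <->
  forall t, 0 <= t -> integrable_rhs (fun s x => f x (w s)) eta t /\
    eta t = picard_op (fun s x => f x (w s)) x0 eta t.
Proof.
split=> Heta t t0; last first.
  have [ie ee] := Heta t t0 => i; split; first exact: ie.
  by rewrite {1}ee mxE.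
split=> [i|]; first by have [] := Heta t t0 i.
by apply/colP => i; rewrite mxE; have [_] := Heta t t0 i.
Qed.

Lemma ode_solution_exists w x0 : L2e w -> exists eta,
  [/\ ode_solution f x0 w eta,
      forall i, measurable_fun setT (fun t => eta t i ord0) &
      forall T, exists2 B, 0 <= B & forall t, t <= T -> `|eta t| <= B].
Proof.
move=> Lw; have [eta [me be se]] :=
  carath_solution_exists L_gt0 (f_lip w) (f_meas Lw) (f_int Lw) x0.
by exists eta; split=> //; apply/ode_solutionP.
Qed.

Lemma ode_solution_unique w x0 eta eta' : ode_solution f x0 w eta ->
  ode_solution f x0 w eta' -> forall t, 0 <= t -> eta t = eta' t.
Proof.
move=> /ode_solutionP se /ode_solutionP se'.
exact: (carath_solution_unique L_gt0 (f_lip w) se se').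
Qed.

Lemma system_output_unique w x0 e e' :
  system_output f g x0 w e -> system_output f g x0 w e' -> e = e'.
Proof.
move=> [eta se eE] [eta' se' eE']; apply/funext => t; rewrite eE eE'.
by case: ifPn => // t0; rewrite (ode_solution_unique se se').
Qed.

Lemma L2e_output_exists w x0 : L2e w ->
  exists2 e, L2e e & system_output f g x0 w e.
Proof.
move=> Lw; have [eta [se me be]] := ode_solution_exists x0 Lw.
pose e t : 'cV[R]_p := if 0 <= t then g (eta t) (w t) else 0.
exists e; last by exists eta.
have m_e i : measurable_fun setT (fun t => e t i ord0).
  rewrite (_ : (fun t => _) =
      (fun t => if 0 <= t then phi (eta t, w t) i ord0 else 0)); last first.
    by apply/funext => t; rewrite /e; case: ifP => //; rewrite mxE.
  apply: measurable_fun_ifT => //; last exact: measurable_phi.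
  exact: measurable_fun_ler.
split=> // [t t0|T T0]; first by rewrite /e leNgt t0.
have [B B0 HB] := be T.
(* On [0, T] the state is bounded by B in the max norm, so its Euclidean square is at most p B^2;
   only the square of the input remains to be integrated. *)
pose A := 2 * a * (p%:R * B ^+ 2) + 2 * sqnorm2 (phi (0, 0)).
apply: le_integrable (integrable_affine_sqnorm2 A (2 * a) Lw T0) => //.
  exact/measurable_EFinP/measurable_funTS/measurable_sqnorm2.
move=> t /=; rewrite in_itv/= => /andP[t0 tT]; rewrite lee_fin.
rewrite ger0_norm ?sqnorm2_ge0// /e t0 /g (le_trans _ (ler_norm _))//.
apply: (le_trans (phi_sqnorm2_le _ _)); rewrite /A mulrDr addrAC !lerD2r.
rewrite ler_pM2l ?mulr_gt0// (le_trans (sqnorm2_le_sqr_normr _))//.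
by rewrite ler_wpM2l// ler_pXn2r ?nnegrE// HB.
Qed.

(** For inputs in [L2e] exactly one output exists, so the default value can matter only for other
    inputs. *)
Let Sigma x0 w : R -> 'cV[R]_p := xget (fun=> 0) [set e | system_output f g x0
  w e].

Lemma io_map_xget : io_map f g Sigma.
Proof.
move=> x0 w Lw; have [e Le se] := L2e_output_exists x0 Lw.
have SE : Sigma x0 w = e.
  rewrite /Sigma; case: xgetP => [e' _ se'|/(_ e)//].
  exact: system_output_unique se' se.
rewrite SE; split=> // e'; split=> [se'|->//].
exact: system_output_unique se' se.
Qed.

(** The energy inequality is applied to the difference of two solutions with supply rate gamma^2
    |dw|^2 - |de|^2. The final energy is nonnegative and the initial one is at most b |dx0|^2, so b
    serves as beta. *)
Lemma incremental_gain_of_dissipation (P : 'M[R]_p) (gamma : R) : posdef P ->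
  (forall x x' (w w' : 'cV[R]_k), let de := phi (x, w) - phi (x', w') :
    'cV[R]_p in
    sqnorm2 de <= 2 * bilin_form P (x - x') de + gamma ^+ 2 * sqnorm2 (w - w'))
      ->
  incremental_L2_gain_le f g gamma.
Proof.
move=> pP diss; have [Ps _] := pP; have [b b0 Hb] := quad_form_le P.
exists Sigma; first exact: io_map_xget.
exists b; first exact: ltW.
move=> T x0 x0' w w' T0 Lw Lw'.
have Hout y (v : R -> 'cV[R]_k) : L2e v -> L2e (Sigma y v) /\
    system_output f g y v (Sigma y v).
  by move=> Lv; have [Le Hs] := io_map_xget y Lv; split=> //; apply/Hs.
have [Le [eta se eE]] := Hout x0 w Lw.
have [Le' [eta' se' eE']] := Hout x0' w' Lw'.
have iE := L2e_sub_integrable Le Le' T0.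
have iW := L2e_sub_integrable Lw Lw' T0.
pose u t := eta t - eta' t.
pose h t := f (eta t) (w t) - f (eta' t) (w' t).
pose psi t := gamma ^+ 2 * sqnorm2 (w t - w' t) - sqnorm2 (Sigma x0 w t - Sigma
  x0' w' t).
have iW2 : mu.-integrable `[0, T] (EFin \o (fun t => gamma ^+ 2 * sqnorm2 (w t
  - w' t))).
  by apply: eq_integrable (integrableZl _ (gamma ^+ 2) iW).
have ipsi : mu.-integrable `[0, T] (EFin \o psi).
  by apply: eq_integrable (integrableB _ iW2 iE).
have eta0 y v z : ode_solution f y v z -> z 0 = y.
  move=> sz; apply/colP => i; have [_ ->] := sz 0 (lexx 0) i.
  by rewrite set_itv1 Rintegral_set1 addr0.
have u0 : u 0 = x0 - x0' by rewrite /u (eta0 _ _ _ se) (eta0 _ _ _ se').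
have hint t i : 0 <= t -> mu.-integrable `[0, t] (EFin \o (fun r => h r i
  ord0)).
  move=> t0; have [[i1 _] [i2 _]] := (se t t0 i, se' t t0 i).
  by apply: eq_integrable (integrableB _ i1 i2) => // r _; rewrite /= !mxE.
have HE : quad_form P (u T) <= quad_form P (u 0) + \int[mu]_(t in `[0, T]) psi
  t.
  apply: (@energy_inequality _ _ P u h psi T Ps (ltW T0)) => //.
  - by move=> i; apply: hint; exact: ltW.
  - move=> t /andP[t0 tT] i; have [[i1 e1] [i2 e2]] := (se t t0 i, se' t t0 i).
    rewrite u0 !mxE e1 e2 opprD addrACA -RintegralB//.
    by congr (_ + _); apply: eq_Rintegral => r _; rewrite /h !mxE.
  (* The derivative h of the difference is - de, so the dissipation inequality bounds 2 h^T P u by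
     the supply rate. *)
  move=> r /andP[r0 rT]; rewrite /psi eE eE' r0 /h /f /g.
  have := diss (eta r) (eta' r) (w r) (w' r) => /=.
  rewrite -opprD bilin_formNl bilin_formC// /u; lra.
(* The gain is stated with extended real integrals; both are finite, which reduces the claim to real
   arithmetic. *)
have finE : (\int[mu]_(t in `[0%R, T]) (sqnorm2 (Sigma x0 w t - Sigma x0' w'
  t))%:E)%E =
   (\int[mu]_(t in `[0, T]) sqnorm2 (Sigma x0 w t - Sigma x0' w' t))%:E.
  by rewrite fineK// (integrable_fin_num _ iE).
have finW : (\int[mu]_(t in `[0%R, T]) (sqnorm2 (w t - w' t))%:E)%E =
   (\int[mu]_(t in `[0, T]) sqnorm2 (w t - w' t))%:E.
  by rewrite fineK// (integrable_fin_num _ iW).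
rewrite finE finW -EFinM -EFinD lee_fin.
have := Hb (u 0); have := posdef_ge0 (u T) pP; move: HE.
rewrite /psi RintegralB// RintegralZl// u0.
move: (Rintegral _ _ _) (Rintegral _ _ _) => ? ?; lra.
Qed.

End lipschitz_system.

(** * Contraction and gain of the reduced dynamics from the dissipation inequality *)

Theorem mainTheorem2 (R : realType) (m nw p np nq : nat) (p_gt0 : (0 < p)%N)
    (pi : 'cV[R]_m * 'cV[R]_nw -> 'cV[R]_p)
    (pi_C1 : continuously_differentiable pi)
    (F : 'M[R]_(p, m)) (G : 'M[R]_(p, np)) (E1 : 'M[R]_(p, nw))
    (H : 'M[R]_(nq, m)) (J : 'M[R]_(nq, np)) (E2 : 'M[R]_(nq, nw))
    (Deltas : set ('cV[R]_nq -> 'cV[R]_np))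
    (Deltas_wp : forall Delta, Deltas Delta ->
       bijective (fun q : 'cV[R]_nq => q - J *m Delta q))
    (Thetas : set 'M[R]_(np + nq))
    (Thetas_cone : convex_cone Thetas)
    (Thetas_sym : forall Theta, Thetas Theta -> Theta^T = Theta)
    (Thetas_qc : forall q q' Theta Delta, Thetas Theta -> Deltas Delta ->
       0 <= quad_form Theta (col_mx (Delta q - Delta q') (q - q')))
    (pi_in : [set lft F G E1 H J E2 Delta | Delta in Deltas] pi)
    (gamma : R) (gamma_ge0 : 0 <= gamma)
    (K : 'M[R]_(m, p)) (P : 'M[R]_p) (P_posdef : posdef P)
    (Theta : 'M[R]_(np + nq)) (Theta_in : Thetas Theta)
    (lmi : let M := lmi_outer F G E1 H J E2 K in
       negdef (M^T *m lmi_middle P Theta gamma *m M)) :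
  uniformly_infinitesimally_contracting (weighted_norm P)
    (fun eta w => - pi (K *m eta, w)) /\
  incremental_L2_gain_le (fun eta w => - pi (K *m eta, w))
    (fun eta w => pi (K *m eta, w)) gamma.
Proof.
have [Delta Delta_in piE] := pi_in.
have Ps := P_posdef.1.
have [c c0 Hc] := lmi_incremental (Deltas_wp _ Delta_in)
  (fun q q' => Thetas_qc q q' _ _ Theta_in Delta_in) Ps lmi piE.
have [a a0 Ha] := lmi_output_growth Ps c0 Hc.
have C1 w := continuously_differentiable_comp_mulmx K w pi_C1.
split.
  split; [exact: weighted_norm_is_norm|exact: C1|].
  have [b b0 Hb] := quad_form_le P.
  (* With equal inputs, dissipation gives dx^T P (- de) <= - (c/2) |dx|^2; the further factor 1/(2b)
     converts this Euclidean rate into one for the P-norm. *)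
  exists (c / 2 / (2 * b)) => [|x w]; first by rewrite !divr_gt0// mulr_gt0.
  apply: weighted_matrix_measure_le => //; first by rewrite divr_gt0.
  move=> v; rewrite col_jacobianE; apply: bilin_form_diff_le; last exact: (C1 w).1.
  move=> y y' /=; have /= := Hc y y' w w.
  rewrite -opprD bilin_formNr subrr sqnorm2_0.
  have := sqnorm2_ge0 (pi (K *m y, w) - pi (K *m y', w)); lra.
pose phi (z : 'cV[R]_p * 'cV[R]_nw) := pi (K *m z.1, z.2).
apply: (@incremental_gain_of_dissipation _ _ _ phi a a0 _ _ P) => //.
  move=> z.
  have c1 : {for z, continuous (fun z : 'cV[R]_p * 'cV[R]_nw => K *m z.1)}.
    by apply: continuous_comp; [exact: cvg_fst|exact: mulmx_continuous].
  have c2 : {for z, continuous (fun z : 'cV[R]_p * 'cV[R]_nw => z.2)} by exact: cvg_snd.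
  have ck : {for z, continuous (fun z : 'cV[R]_p * 'cV[R]_nw => (K *m z.1, z.2))}.
    exact: (cvg_pair c1 c2).
  apply: (continuous_comp ck); exact/differentiable_continuous/pi_C1.1.
move=> x x' w w' /=; have /= := Hc x x' w w'.
(* The gain estimate discards the strict decrease c |dx|^2. *)
have := mulr_ge0 (ltW c0) (sqnorm2_ge0 (x - x')); rewrite /phi/=; lra.
Qed.
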